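(* Let $G$ be a finitely presented group, and suppose that, for each natural number $i$, there is a triple $H_i \geq J_i \geq K_i$ of finite index normal subgroups of $G$ such that (i) $H_i/J_i$ is abelian for all $i$; (ii) $\lim_{i \rightarrow \infty} \dfrac{\log [H_i : J_i]}{[G:H_i]} = \infty$; (iii) $\limsup_{i\to\infty} \dfrac{d(J_i/K_i)}{[G:J_i]} > 0$. Then, for infinitely many $i$, $K_i$ admits a surjective homomorphism onto a free non-abelian group.
   Context: For a finitely generated group $\Gamma$, $d(\Gamma)$ denotes its rank, i.e. the minimal number of elements in a generating set of $\Gamma$. *)

(* Defs.v *)
From HB Require Import structures.
From mathcomp Require Import all_boot all_order all_algebra finmap.
From mathcomp Require Import all_classical all_reals all_analysis.

Set Implicit Arguments.
Unset Strict Implicit.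
Unset Printing Implicit Defensive.

Import Order.TTheory GRing.Theory Num.Theory.
Import numFieldNormedType.Exports.

Local Open Scope classical_set_scope.
Local Open Scope quotient_scope.
Local Open Scope group_scope.

Section Subgroups.
Variable G : groupType.
Implicit Types A B X : set G.

Definition is_subgroup A : Prop := group_closed (mem A).

Definition is_normal A : Prop :=
  is_subgroup A /\ forall x g : G, A x -> A (x ^ g).

Definition is_abelian A : Prop := {in A &, commutative ( *%g : G -> G -> G)}.

Definition generated_subgroup X : set G := smallest is_subgroup X.

Definition normal_closure X : set G := smallest is_normal X.

Definition lcosets A B : set (set G) :=
  [set [set x * b | b in B] | x in A].

(* The index [A : B], for B a subgroup of finite index of A; it is 0 when the
   index is infinite. *)
Definition subgroup_index A B : nat := #|` fset_set (lcosets A B) |.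

Definition has_finite_index B : Prop := finite_set (lcosets [set: G] B).

Definition generated_by_card A (n : nat) : Prop :=
  exists X : {fset G}, #|` X| = n /\ generated_subgroup [set` X] = A.

(* The rank d(A) of a finitely generated subgroup A; it is 0 when A is not
   finitely generated. *)
Definition group_rank A : nat :=
  xget 0 [set n | generated_by_card A n /\
                  forall m, generated_by_card A m -> (n <= m)%N].

Record normal_subgroup := NormalSubgroup {
  nsub_set :> set G;
  nsub_normal : is_normal nsub_set
}.

End Subgroups.

Section SubgroupAsGroup.
Variables (G : groupType) (K : normal_subgroup G).

Definition subgroup_type : Type := {x : G | x \in nsub_set K}.

HB.instance Definition _ := SubType.on subgroup_type.
HB.instance Definition _ := Choice.on subgroup_type.
HB.instance Definition _ :=
  SubChoice_isSubGroup.Build G _ subgroup_type (nsub_normal K).1.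

End SubgroupAsGroup.

Section Quotient.
Variables (G : groupType) (K : normal_subgroup G).
Implicit Types x y z : G.

Definition coset_rel x y : bool := x^-1 * y \in nsub_set K.

Let KM : {in nsub_set K &, forall x y, x * y \in nsub_set K}.
Proof. exact: (group_closedM (nsub_normal K).1). Qed.

Let KV : {in nsub_set K, forall x, x^-1 \in nsub_set K}.
Proof. exact: (group_closedV (nsub_normal K).1). Qed.

Let KJ x g : x \in nsub_set K -> x ^ g \in nsub_set K.
Proof. by rewrite !inE; exact: (nsub_normal K).2. Qed.

Lemma coset_rel_equiv : equiv_class_of coset_rel.
Proof.
split=> [x|x y|y x z]; rewrite /coset_rel.
- by rewrite mulVg; exact: (nsub_normal K).1.1.
- by apply/idP/idP => /KV; rewrite invgM invgK.
- by move=> xy /(KM xy); rewrite mulgA mulgK.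
Qed.

Canonical coset_equiv := EquivRelPack coset_rel_equiv.

Definition quotient_group : Type := {eq_quot coset_equiv}.

HB.instance Definition _ := Choice.on quotient_group.
HB.instance Definition _ := EqQuotient.on quotient_group.

Definition coset_proj x : quotient_group := \pi_quotient_group x.

Lemma coset_projP x y :
  reflect (coset_proj x = coset_proj y) (x^-1 * y \in nsub_set K).
Proof. exact: eqmodP. Qed.

Let qmul (a b : quotient_group) : quotient_group :=
  coset_proj (repr a * repr b).
Let qinv (a : quotient_group) : quotient_group := coset_proj (repr a)^-1.

Let coset_projK a : coset_proj (repr a) = a.
Proof. exact: reprK. Qed.

Let qmulE x y : qmul (coset_proj x) (coset_proj y) = coset_proj (x * y).
Proof.
have /coset_projP hx := coset_projK (coset_proj x).
have /coset_projP hy := coset_projK (coset_proj y).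
apply/coset_projP; set x' := repr _ in hx *; set y' := repr _ in hy *.
suff -> : (x' * y')^-1 * (x * y) = (x'^-1 * x) ^ y' * (y'^-1 * y).
  by apply: KM => //; exact: KJ.
by rewrite /conjg invgM -!mulgA mulVKg.
Qed.

Let qinvE x : qinv (coset_proj x) = coset_proj x^-1.
Proof.
have /coset_projP hx := coset_projK (coset_proj x).
apply/coset_projP; set x' := repr _ in hx *.
have /(KJ x'^-1)/KV := hx.
by rewrite /conjg invgK mulgA mulVKg invgM invgK.
Qed.

Let qmulA : associative qmul.
Proof.
move=> a b c; rewrite -(coset_projK a) -(coset_projK b) -(coset_projK c).
by rewrite !qmulE mulgA.
Qed.

Let qmul1g : left_id (coset_proj 1) qmul.
Proof. by move=> a; rewrite -(coset_projK a) qmulE mul1g. Qed.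

Let qmulg1 : right_id (coset_proj 1) qmul.
Proof. by move=> a; rewrite -(coset_projK a) qmulE mulg1. Qed.

Let qmulVg : left_inverse (coset_proj 1) qinv qmul.
Proof. by move=> a; rewrite -(coset_projK a) qinvE qmulE mulVg. Qed.

Let qmulgV : right_inverse (coset_proj 1) qinv qmul.
Proof. by move=> a; rewrite -(coset_projK a) qinvE qmulE mulgV. Qed.

HB.instance Definition _ :=
  isGroup.Build quotient_group qmulA qmul1g qmulg1 qmulVg qmulgV.

Lemma coset_is_multiplicative : {morph coset_proj : x y / x * y}.
Proof. by move=> x y; rewrite -qmulE. Qed.

HB.instance Definition _ :=
  isMultiplicative.Build G quotient_group coset_proj coset_is_multiplicative.

End Quotient.

(* A / K, as a subset of the group G / K, for K contained in A *)
Definition quotient_set (G : groupType) (A : set G) (K : normal_subgroup G) :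
  set (quotient_group K) := [set coset_proj K x | x in A].
Arguments quotient_set {G} A K.

(* The free group on X: reduced words in the letters (x, b), where (x, true)
   stands for x and (x, false) for its inverse. *)
Section FreeGroup.
Variable X : choiceType.
Implicit Types (a b : X * bool) (u v w : seq (X * bool)).

Definition flip a := (a.1, ~~ a.2).

Definition reduced w : bool := sorted (fun a b => b != flip a) w.

Definition free_group : Type := {w : seq (X * bool) | reduced w}.

HB.instance Definition _ := SubType.on free_group.
HB.instance Definition _ := Choice.on free_group.

(* Reduced form of a :: w, for w reduced. *)
Definition push a w :=
  if w is b :: w' then if b == flip a then w' else a :: w else [:: a].

(* Reduced form of u ++ v, for v reduced. *)
Definition word_mul u v := foldr push v u.

Definition word_inv u := rev (map flip u).

Let flipK : involutive flip.
Proof. by case=> x b; rewrite /flip negbK. Qed.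

Let push_reduced a w : reduced w -> reduced (push a w).
Proof.
case: w => //= b w; case: ifPn => [_|ba] bw; last by rewrite /reduced /= ba.
exact: path_sorted bw.
Qed.

Let mul_reduced u v : reduced v -> reduced (word_mul u v).
Proof. by move=> rv; elim: u => //= a u; exact: push_reduced. Qed.

Let pushK a w : reduced w -> push (flip a) (push a w) = w.
Proof.
case: w => [|b w] /=; first by rewrite flipK eqxx.
case: eqP => [->|ba] /=; last by rewrite flipK eqxx.
by case: w => //= c w /andP[/negPf ->].
Qed.

Let push_mul a v w : reduced v -> reduced w ->
  word_mul (push a v) w = push a (word_mul v w).
Proof.
case: v => [|b v] //= rv rw; case: eqP => [->|//] /=.
by rewrite -{1}(flipK a) pushK //; exact: mul_reduced.
Qed.

Let mulA u v w : reduced v -> reduced w ->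
  word_mul u (word_mul v w) = word_mul (word_mul u v) w.
Proof.
move=> rv rw; elim: u => //= a u ->.
by rewrite push_mul //; exact: mul_reduced.
Qed.

Let mulw1 u : reduced u -> word_mul u [::] = u.
Proof.
elim: u => //= a u IHu ru; rewrite IHu; last exact: path_sorted ru.
by case: u ru {IHu} => //= b u /andP[/negPf ->].
Qed.

Let inv_reduced u : reduced u -> reduced (word_inv u).
Proof.
move=> ru; rewrite /reduced /word_inv rev_sorted sorted_map.
by apply: sub_sorted ru => a b /=; rewrite flipK eq_sym.
Qed.

Let mulVw u v : reduced v -> word_mul (word_inv u) (word_mul u v) = v.
Proof.
elim: u => //= a u IHu rv.
rewrite /word_inv /= rev_cons -cats1 /word_mul foldr_cat /=.
by rewrite pushK; [exact: IHu | exact: mul_reduced].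
Qed.

Let invK u : word_inv (word_inv u) = u.
Proof. by rewrite /word_inv map_rev revK mapK. Qed.

Definition fg_one : free_group := exist reduced [::] isT.
Definition fg_mul (x y : free_group) : free_group :=
  exist reduced (word_mul (val x) (val y)) (mul_reduced (val x) (valP y)).
Definition fg_inv (x : free_group) : free_group :=
  exist reduced (word_inv (val x)) (inv_reduced (valP x)).

Let fg_mulA : associative fg_mul.
Proof. by move=> x y z; apply/val_inj/mulA; exact: valP. Qed.

Let fg_mul1g : left_id fg_one fg_mul.
Proof. by move=> x; exact/val_inj. Qed.

Let fg_mulg1 : right_id fg_one fg_mul.
Proof. by move=> x; apply/val_inj/mulw1; exact: valP. Qed.

Let fg_mulVg : left_inverse fg_one fg_inv fg_mul.
Proof.
move=> x; apply/val_inj => /=.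
by rewrite -[X in word_mul _ X](mulw1 (valP x)) mulVw.
Qed.

Let fg_mulgV : right_inverse fg_one fg_inv fg_mul.
Proof.
move=> x; rewrite -[X in fg_mul X _](_ : fg_inv (fg_inv x) = x) ?fg_mulVg //.
by apply/val_inj; exact: invK.
Qed.

HB.instance Definition _ :=
  isGroup.Build free_group fg_mulA fg_mul1g fg_mulg1 fg_mulVg fg_mulgV.

End FreeGroup.

Definition finitely_presented (G : groupType) : Prop :=
  exists (n : nat) (f : {multiplicative free_group 'I_n -> G})
         (R : {fset free_group 'I_n}),
    range f = [set: G] /\ f @^-1` [set 1] = normal_closure [set` R].

Definition surjects_onto_nonabelian_free (G : groupType) : Prop :=
  exists (X : choiceType) (f : {multiplicative G -> free_group X}),
    range f = [set: free_group X] /\ ~ is_abelian [set: free_group X].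

(* Main.v *)
(* Work in the Cayley graph of the finite group W = G / K with respect to the
   ball B of radius the maximal length of a relator, and put Q = J / K. A
   function on the edges whose product around every triangle is trivial is
   trivial on all relators, hence restricts to a morphism defined on K.

   As H / J is abelian and exponentially large compared with [G : H], it has
   Folner sets, and these provide a Q-invariant cut of W into two large parts
   with few edges across. Group the edges across the cut into classes
   generated by lying in a common triangle. If two classes can be deleted
   without disconnecting the graph, the signed crossings with these two
   classes map K onto a free group of rank 2. Otherwise, for each Q-orbit of
   classes, comparing the number of its classes with the number of components
   they separate shows that one side is light: the part of Q that it carries is
   generated by the stabiliser of a class and boundedly many elements, hence by
   few elements. The light sides together contain one of the two parts of the
   cut, and boundedly many translates of that part cover almost all of W. So Q
   is generated by few elements compared with [G : J], against (iii). *)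

(* Edges and generators are made comparable: a generator of [Q] costs [#|Q|], an edge costs 1, and
   by (iii) generating [Q] costs at least a fixed fraction of [#|W|]. The stabiliser of a class acts
   freely on the class, which is connected under sliding and has at most [2 * #|B|] slides at each
   edge, so its generators cost a multiple of the number of cut edges in the orbit of that class.
   This is why the cut must be sparse.

   The factor 3 separates the two cases. A [Q]-orbit of classes and the components left after
   deleting it form a connected graph with one orbit of edges and at most two of vertices. If both
   vertex stabilisers are at least three times as large as the edge stabiliser, there are so few
   vertices that a spanning tree omits two edges. Otherwise some vertex stabiliser contains the edge
   stabiliser with index at most 2 and needs at most one generator more.

   All constants depend only on the presentation and on the bound from (iii), because [#|B|] is
   bounded uniformly over the finite quotients. So a single triple is treated, and limits only
   select suitable indices. *)
From mathcomp Require Import all_boot all_fingroup all_solvable zify.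

Set Implicit Arguments.
Unset Strict Implicit.
Unset Printing Implicit Defensive.

Local Open Scope group_scope.

(** * Cuts of finite abelian groups *)

Section Folner.
Variable gT : finGroupType.
Implicit Types (A : {group gT}) (D F : {set gT}) (s : seq gT).

(** [s] is a list because different edges may carry the same element of [H / Q] as label, and each
    of them counts. *)
Definition shift_boundary s D : nat :=
  \sum_(h <- s) #|[set a in D | (a * h)%g \notin D]|.

(** Products of powers of the entries of [s] with non-negative exponents of sum at most [r]. The
    nested recursions follow Pascal's rule for counting such exponents. *)
Fixpoint monomial_ball s : nat -> {set gT} :=
  if s is h :: s' then
    fix ball r := if r is r'.+1
      then monomial_ball s' r'.+1 :|: [set h * x | x in ball r']
      else monomial_ball s' 0
  else fun=> [set 1].

Lemma monomial_ball_sub A s r :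
  {subset s <= A} -> monomial_ball s r \subset A.
Proof.
elim: s r => [|h s IHs] r sA; first by rewrite sub1set group1.
have {}IHs r' : monomial_ball s r' \subset A.
  by apply: IHs => x xs; apply: sA; rewrite inE xs orbT.
have hA : h \in A by apply: sA; rewrite mem_head.
elim: r => [|r IHr] /=; first exact: IHs.
rewrite subUset IHs; apply/subsetP => _ /imsetP[x xB ->].
by rewrite groupM // (subsetP IHr).
Qed.

Lemma monomial_ballS s r : monomial_ball s r \subset monomial_ball s r.+1.
Proof.
elim: s r => [|h s IHs] r //; elim: r => [|r IHr] /=.
  exact: subset_trans (IHs 0) (subsetUl _ _).
by rewrite setUSS ?imsetS //; exact: IHs.
Qed.

Lemma monomial_ball_gt0 s r : 0 < #|monomial_ball s r|.
Proof.
elim: s r => [|h s IHs] r; first by rewrite cards1.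
by case: r => [|r] /=; [exact: IHs | apply: leq_trans (IHs r.+1) (subset_leq_card (subsetUl _ _))].
Qed.

Lemma monomial_ball_mul A s r a h : abelian A -> {subset s <= A} ->
  a \in monomial_ball s r -> h \in s -> a * h \in monomial_ball s r.+1.
Proof.
move=> abA; elim: s r a => [|h0 s IHs] r a sA //.
have sA' : {subset s <= A} by move=> x xs; apply: sA; rewrite inE xs orbT.
move=> aB; have aA := subsetP (monomial_ball_sub r sA) _ aB.
rewrite inE => /predU1P[->|hs].
  rewrite (centsP abA a aA h0) ?sA ?mem_head //=.
  by rewrite inE orbC imset_f.
elim: r a aB {aA} => [|r IHr] a; first by rewrite inE => aB; rewrite IHs.
rewrite inE => /orP[aB|/imsetP[x xB ->]]; first by rewrite inE IHs.
by rewrite inE orbC -mulgA imset_f // IHr.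
Qed.

(** With k the size of [s], there are at most binom(r + k, r) exponent vectors, and binom(r + k, r)
    a^r is one term of the expansion of (a + 1)^(r + k). *)
Lemma card_monomial_ball s r a : (0 < a)%N ->
  (a ^ r * #|monomial_ball s r| <= a.+1 ^ (r + size s))%N.
Proof.
move=> a_gt0; elim: s r => [|h s IHs] r.
  by rewrite /= cards1 muln1 addn0; case: r => // r; rewrite leq_exp2r.
elim: r => [|r IHr] /=.
  by apply: leq_trans (IHs 0) _; rewrite leq_pexp2l // addnS leqW.
have le_card : #|monomial_ball s r.+1 :|: [set h * x | x in monomial_ball (h :: s) r]|
    <= (#|monomial_ball s r.+1| + #|monomial_ball (h :: s) r|)%N.
  by rewrite (leq_trans (leq_card_setU _ _)) // leq_add2l leq_imset_card.
apply: leq_trans (leq_mul (leqnn (a ^ r.+1)) le_card) _.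
rewrite mulnDr addnS [leqRHS]expnS mulSn; apply: leq_add (IHs _) _.
by rewrite expnS -mulnA leq_mul2l addSnnS IHr orbT.
Qed.

Lemma leq_expn_Bernoulli m c : (m ^ c.+1 + c.+1 * m ^ c <= m.+1 ^ c.+1)%N.
Proof.
elim: c => [|c IHc]; first by rewrite !expn1 expn0 muln1 addn1.
rewrite [leqRHS]expnS (leq_trans _ (leq_mul (leqnn m.+1) IHc)) //.
rewrite mulnDr mulSn mulnCA !expnS; lia.
Qed.

(* Otherwise the balls grow at least like [(1 + 1/k) ^ r], against
   [card_monomial_ball] for [a = 2 k]. *)
Lemma monomial_ball_slow_growth s k (m := k.*2.+1) :
  (0 < k)%N -> (0 < size s)%N ->
  exists2 r, (r < m ^ 2 * size s)%N &
    (k * #|monomial_ball s r.+1| <= k.+1 * #|monomial_ball s r|)%N.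
Proof.
move=> k_gt0 s_gt0; set c := (m ^ 2)%N; set N := size s.
set f := fun r => #|monomial_ball s r|.
have [/existsP[r slow]|] := boolP [exists r : 'I_(c * N), k * f r.+1 <= k.+1 * f r]%N.
  by exists r.
rewrite negb_exists => /forallP fast.
have growth r : (r <= c * N)%N -> (k.+1 ^ r <= k ^ r * f r)%N.
  elim: r => [|r IHr] le_r; first by rewrite mul1n monomial_ball_gt0.
  have := fast (Ordinal le_r); rewrite /= -ltnNge => /ltnW fast_r.
  rewrite !expnS -mulnA (leq_trans (leq_mul (leqnn k.+1) (IHr (ltnW le_r)))) //.
  by rewrite mulnCA [leqRHS]mulnCA leq_mul2l fast_r orbT.
have m_gt0 : (0 < m)%N by [].
(* Since c = m^2, the second term c m^(c-1) of the expansion of (m + 1)^c is already m^(c+1). *)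
have Bern : (m ^ c.+1 < m.+1 ^ c)%N.
  have c_gt0 : (0 < c)%N by rewrite expn_gt0.
  have := leq_expn_Bernoulli m c.-1; rewrite prednK //; apply: leq_trans.
  have -> : (m ^ c.+1 = c * m ^ c.-1)%N by rewrite /c -expnD; congr (_ ^ _)%N; lia.
  by rewrite -addn1 addnC leq_add2r expn_gt0.
(* For a = 2 k one has a (k + 1) = k (m + 1), so the powers of k cancel. *)
have contra : (m.+1 ^ (c * N) <= m ^ (c * N + N))%N.
  have := leq_mul (leqnn (k.*2 ^ (c * N))) (growth _ (leqnn _)).
  rewrite mulnCA => le1; have := leq_trans le1 (leq_mul (leqnn _) (card_monomial_ball s (c * N) _)).
  have k2_gt0 : (0 < k.*2)%N by rewrite double_gt0.
  move=> /(_ k2_gt0); rewrite -/m -/N -expnMn.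
  have -> : (k.*2 * k.+1 = k * m.+1)%N by rewrite /m; lia.
  by rewrite expnMn leq_pmul2l // expn_gt0 k_gt0.
suff : (m ^ (c * N + N) < m.+1 ^ (c * N))%N by rewrite ltnNge contra.
by rewrite -{2}[N]mul1n -mulnDl addn1 !(expnM _ _ N) ltn_exp2r.
Qed.

Lemma shift_boundaryU s D F :
  (shift_boundary s (D :|: F) <= shift_boundary s D + shift_boundary s F)%N.
Proof.
rewrite /shift_boundary -big_split /=; apply: leq_sum => h _.
apply: leq_trans _ (leq_card_setU _ _).
apply/subset_leq_card/subsetP => a; rewrite !inE negb_or.
by case/andP=> /orP[->|->] /andP[-> ->]; rewrite ?orbT.
Qed.

Lemma shift_boundary_translate s D g :
  shift_boundary s (g *: D) = shift_boundary s D.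
Proof.
apply: eq_bigr => h _; rewrite -[RHS](card_lcoset _ g); apply: eq_card => a.
by rewrite !(inE, mem_lcoset) mulgA.
Qed.

(** Over all g in [A], the average size of the intersection of g F with [D] is |F| |D| / |A|. *)
Lemma exists_translate_small_meet A D F : D \subset A -> F \subset A ->
  exists2 g, g \in A & (#|g *: F :&: D| * #|A| <= #|F| * #|D|)%N.
Proof.
move=> DA FA; have [/exists_inP//|/exists_inPn big] :=
  boolP [exists g in A, #|g *: F :&: D| * #|A| <= #|F| * #|D|]%N.
have count : (\sum_(g in A) #|g *: F :&: D| = #|F| * #|D|)%N.
  transitivity (\sum_(g in A) \sum_(x in D) (x \in g *: F))%N.
    apply: eq_bigr => g _; rewrite -sum1_card big_mkcond [RHS]big_mkcond /=.
    by apply: eq_bigr => x _; rewrite inE andbC; case: (x \in D); case: (x \in _).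
  rewrite exchange_big /= mulnC -sum_nat_const; apply: eq_bigr => x xD.
  have xA := subsetP DA _ xD.
  transitivity #|[set x * y^-1 | y in F]|.
    rewrite -sum1_card big_mkcond [RHS]big_mkcond /=; apply: eq_bigr => g _.
    suff -> : (g \in [set x * y^-1 | y in F]) = (g \in A) && (x \in g *: F).
      by case: (g \in A); case: (x \in _).
    rewrite mem_lcoset; apply/imsetP/andP => [[y yF ->]|[gA gF]].
      split; first by rewrite groupM // groupV (subsetP FA).
      by rewrite invMg invgK mulgKV.
    by exists (g^-1 * x); rewrite // invMg invgK mulKVg.
  by rewrite card_imset // => y z /mulgI/invg_inj.
have : (\sum_(g in A) #|F| * #|D| < \sum_(g in A) #|g *: F :&: D| * #|A|)%N.
  rewrite (bigD1 1) //= [ltnRHS](bigD1 1) //= -addSn leq_add //.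
    by rewrite ltnNge big.
  by apply: leq_sum => g /andP[gA _]; rewrite ltnW // ltnNge big.
by rewrite sum_nat_const -big_distrl /= count mulnC ltnn.
Qed.

(* A largest [D] with [k * boundary <= 2 * size s * #|D|] filling at most half
   of [A]: if it were small, a suitable translate of a ball of slow growth could
   still be added. *)
Lemma abelian_Folner_cut A s k (m := k.*2.+1) :
  (0 < k)%N -> (0 < size s)%N -> abelian A -> {subset s <= A} ->
  ((4 * m ^ (m ^ 2).+1) ^ size s <= #|A|)%N ->
  exists D : {set gT}, [/\ D \subset A, (#|A| <= 4 * #|D|)%N,
    (2 * #|D| <= #|A|)%N & (k * shift_boundary s D <= size s * #|A|)%N].
Proof.
move=> k_gt0 s_gt0 abA sA A_big.
have [r lt_r slow] := monomial_ball_slow_growth k_gt0 s_gt0.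
set N := size s in s_gt0 lt_r A_big *; set F := monomial_ball s r.
have FA : F \subset A by exact: monomial_ball_sub.
have bF : (k * shift_boundary s F <= N * #|F|)%N.
  have bF h : h \in s -> (k * #|[set a in F | (a * h)%g \notin F]| <= #|F|)%N.
    move=> hs; have FS : #|monomial_ball s r.+1| = (#|monomial_ball s r.+1 :\: F| + #|F|)%N.
      rewrite -[LHS](cardsID F) addnC; congr (_ + _)%N.
      by congr #|pred_of_set _|; apply/setIidPr; exact: monomial_ballS.
    apply: leq_trans (_ : k * #|monomial_ball s r.+1 :\: F| <= _)%N; last first.
      by move: slow; rewrite FS mulnDr mulSn leq_add2r.
    rewrite leq_mul2l -(card_rcoset _ h); apply/orP; right.
    apply/subset_leq_card/subsetP => x; rewrite mem_rcoset !inE mulgKV => /andP[xF ->].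
    by rewrite -[x](mulgKV h) (monomial_ball_mul abA).
  rewrite /shift_boundary big_distrr /= big_seq (leq_trans (leq_sum _ bF)) //.
  by rewrite -big_seq big_const_seq count_predT iter_addn_0 mulnC.
(* As r < m^2 N, the ball has at most m^((m^2 + 1) N) elements, and 4 is at most 4^N. *)
have F_small : (4 * #|F| <= #|A|)%N.
  apply: leq_trans A_big; rewrite expnMn leq_mul //; first by rewrite -[leqLHS]expn1 leq_pexp2l.
  rewrite -expnM; have := card_monomial_ball s r (_ : 0 < k.*2)%N.
  rewrite double_gt0 => /(_ k_gt0); rewrite -/m -/N => le_F.
  apply: leq_trans (leq_trans (leq_pmull _ _) le_F) _.
    by rewrite expn_gt0 double_gt0 k_gt0.
  by rewrite leq_pexp2l // mulSn addnC leq_add2l ltnW.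
(* The factor 2 leaves room for overlaps: if a translate of [F] meets [D] in M elements and 2 M is
   at most |F|, then N |F|, which bounds k times its boundary, is at most 2 N (|F| - M), the growth
   of the right-hand side. *)
pose P (D : {set gT}) := [&& D \subset A, 2 * #|D| <= #|A| &
                         k * shift_boundary s D <= 2 * N * #|D|]%N.
have P0 : P set0.
  rewrite /P sub0set cards0 /= muln0 /shift_boundary big1 ?muln0 // => h _.
  by apply/eqP; rewrite cards_eq0; apply/eqP/setP => x; rewrite !inE.
case: (@arg_maxnP _ set0 P (fun D => #|D|) P0) => D /and3P[DA D_half bD] D_max.
have D_big : (#|A| <= 4 * #|D|)%N.
  rewrite leqNgt; apply/negP => D_small.
  have [g gA] := exists_translate_small_meet DA FA.
  set M := #|g *: F :&: D| => le_M.
  have lt_M : (2 * M <= #|F|)%N.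
    have F_gt0 : (0 < #|F|)%N by exact: monomial_ball_gt0.
    have A_gt0 : (0 < #|A|)%N by exact: cardG_gt0.
    by rewrite -(leq_pmul2r A_gt0); nia.
  have cardDF : (#|D :|: g *: F| + M = #|D| + #|F|)%N.
    rewrite cardsU card_lcoset -/M setIC subnK //.
    by apply: leq_trans (leq_addr _ _); rewrite subset_leq_card // subsetIr.
  have lt_D : (#|D| < #|D :|: g *: F|)%N.
    have : (0 < #|F|)%N by exact: monomial_ball_gt0.
    by lia.
  suff /D_max : P (D :|: g *: F) by rewrite /= leqNgt lt_D.
  apply/and3P; split.
  - rewrite subUset DA; apply/subsetP => x; rewrite mem_lcoset => /(subsetP FA) xA.
    by rewrite -[x](mulKVg g) groupM.
  - by lia.
  - apply: leq_trans (leq_mul (leqnn k) (shift_boundaryU _ _ _)) _.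
    rewrite shift_boundary_translate mulnDr.
    by have := leq_mul (leqnn N) lt_M; nia.
exists D; split=> //; apply: leq_trans bD _.
by rewrite -mulnA mulnCA leq_mul2l D_half orbT.
Qed.

End Folner.

(** * Lifting a cut of H / Q to the Cayley graph *)

Section LiftedCut.
Variables (gT : finGroupType) (Q H : {group gT}).
Hypothesis nQ : Q <| [set: gT].
Implicit Types (x y h t : gT).

Let memN x : x \in 'N(Q).
Proof. by rewrite (subsetP (normal_norm nQ)). Qed.

Let tau x := repr (H :* x).

Let tau_mem x : tau x \in H :* x.
Proof. exact: mem_repr_rcoset. Qed.

Let tauH h x : h \in H -> tau (h * x) = tau x.
Proof. by move=> hH; rewrite /tau rcosetM (rcoset_id hH). Qed.

Let tau_ratio x : x * (tau x)^-1 \in H.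
Proof. by rewrite -mem_rcoset rcoset_sym. Qed.

Let tauM x y : tau (x * y) = tau (tau x * y).
Proof. by rewrite -{1}[x](mulgKV (tau x)) -mulgA tauH. Qed.

Let card_tau : #|tau @: [set: gT]| = #|[set: gT] : H|.
Proof.
rewrite -[RHS](card_in_imset (f := repr)); last first.
  move=> _ _ /rcosetsP[x _ ->] /rcosetsP[y _ ->] eq_xy.
  by rewrite -(rcoset_eqP (tau_mem x)) /tau eq_xy (rcoset_eqP (tau_mem y)).
apply: eq_card => t; apply/imsetP/imsetP => [[x _ ->]|[_ /rcosetsP[x _ ->] ->]].
  by exists (H :* x) => //; apply/rcosetsP; exists x.
by exists x.
Qed.

Let sum_tau (g : gT -> nat) :
  (\sum_x g (tau x) = #|H| * \sum_(t in tau @: [set: gT]) g t)%N.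
Proof.
rewrite big_distrr /= (partition_big tau (mem (tau @: [set: gT]))) /=; last first.
  by move=> x _; rewrite imset_f.
apply: eq_bigr => _ /imsetP[x _ ->].
rewrite (eq_bigr (fun=> g (tau x))) => [|y /eqP-> //].
rewrite sum_nat_const -(card_rcoset H x); congr (_ * _)%N.
apply: eq_card => y; rewrite unfold_in /=; apply/eqP/idP => [eq_y|].
  by rewrite -(rcoset_eqP (tau_mem x)) -eq_y rcoset_sym.
by rewrite mem_rcoset => /(tauH x); rewrite mulgKV.
Qed.

Let card_coset_preim (X : {set coset_of Q}) (P := [set h in H | coset Q h \in X]) :
  Q \subset H -> X \subset H / Q -> #|P| = (#|Q| * #|X|)%N.
Proof.
move=> QH XH; rewrite -sum1_card (partition_big (coset Q) (mem X)) /=; last first.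
  by move=> h; rewrite inE => /andP[].
rewrite mulnC -sum_nat_const; apply: eq_bigr => a aX.
have /morphimP[h _ hH def_a] := subsetP XH a aX.
rewrite sum1dep_card -(card_rcoset Q h); apply: eq_card => x.
rewrite !inE; apply/andP/idP => [[/andP[xH _] /eqP]|xh].
  by rewrite def_a => /rcoset_kercosetP ->.
have eq_a : coset Q x = a by rewrite def_a; apply/rcoset_kercosetP.
rewrite eq_a eqxx aX andbT; split=> //.
by have := xh; rewrite mem_rcoset => /(subsetP QH) /groupM/(_ hH); rewrite mulgKV.
Qed.

(** Double counting: each element of [X] is seen from all [#|H|] points of its right coset of [H].
    Cardinals in the whole group thus reduce to counts inside [H]. *)
Let sum_translate (X : {set gT}) :
  (\sum_x #|[set h in H | (h * x)%g \in X]| = #|H| * #|X|)%N.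
Proof.
rewrite -sum_nat_const.
transitivity (\sum_(h in H) \sum_x ((h * x)%g \in X : nat))%N.
  rewrite exchange_big; apply: eq_bigr => x _.
  by rewrite -sum1dep_card big_mkcondr.
apply: eq_bigr => h hH; rewrite -(card_lcoset X h^-1) -sum1_card [RHS]big_mkcond /=.
by apply: eq_bigr => x _; rewrite mem_lcoset invgK; case: ifP.
Qed.

Variable B : {set gT}.

(** The edges across the cut, each recorded once and oriented from [D] to its complement. *)
Definition cut_pairs (D : {set gT}) : {set gT * gT} :=
  [set p | [&& p.1 \in D, p.2 \notin D & p.1^-1 * p.2 \in B]].

Lemma card_cut_pairs D :
  #|cut_pairs D| = (\sum_(b in B) #|[set x in D | (x * b)%g \notin D]|)%N.
Proof.
rewrite -sum1_card (partition_big (fun p => p.1^-1 * p.2) (mem B)) /=; last first.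
  by case=> x y; rewrite inE => /and3P[].
apply: eq_bigr => b bB; rewrite sum1dep_card.
rewrite -(card_imset _ (_ : injective (fun x => (x, x * b)))); last by move=> x y [].
apply: eq_card => -[x y]; rewrite !inE /=; apply/andP/imsetP => [[/and3P[xD yD _] /eqP <-]|].
  by exists x; rewrite ?mulKVg // inE xD mulKVg.
by case=> z; rewrite inE => /andP[zD zbD] [-> ->]; rewrite zD zbD mulKg bB.
Qed.

(* The cut of [H / Q] is spread over the right cosets [H :* t], so that an edge
   from [t] labelled [b] acts on [H / Q] as multiplication by [eta t b]. *)
Lemma Folner_cut k (m := k.*2.+1) :
  (0 < k)%N -> B != set0 -> Q \subset H -> abelian (H / Q) ->
  ((4 * m ^ (m ^ 2).+1) ^ (#|[set: gT] : H| * #|B|) <= #|H / Q|)%N ->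
  exists D : {set gT}, [/\ forall q x, q \in Q -> (q * x \in D) = (x \in D),
    (#|gT| <= 4 * #|D|)%N, (2 * #|D| <= #|gT|)%N &
    (k * #|cut_pairs D| <= #|B| * #|gT|)%N].
Proof.
move=> k_gt0 B_neq0 QH abHQ big.
pose eta t b := coset Q (t * b * (tau (t * b))^-1).
(* One label for each coset of [H] and each element of [B]: the number of labels is the exponent in
   the size hypothesis, and this is how [G : H] enters. *)
pose s := [seq eta t b | t <- enum (tau @: [set: gT]), b <- enum B].
have size_s : size s = (#|[set: gT] : H| * #|B|)%N.
  by rewrite size_allpairs -!cardE card_tau.
have [||||D0 [D0H D0_big D0_half bD0]] := @abelian_Folner_cut _ (H / Q) s k k_gt0.
- by rewrite size_s muln_gt0 indexg_gt0 card_gt0.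
- by [].
- by move=> _ /allpairsP[[t b] [_ _ ->]]; rewrite mem_quotient.
- by rewrite size_s.
pose D := [set x | coset Q (x * (tau x)^-1) \in D0].
have memD h x : h \in H -> (h * x \in D) = (coset Q (h * (x * (tau x)^-1)) \in D0).
  by move=> hH; rewrite inE tauH // mulgA.
have cardQ : #|H| = (#|H / Q| * #|Q|)%N.
  by rewrite card_quotient ?(subset_trans _ (normal_norm nQ)) // mulnC Lagrange.
have card_shift (X : {set coset_of Q}) u : X \subset H / Q -> u \in H ->
    #|[set h in H | coset Q (h * u) \in X]| = (#|Q| * #|X|)%N.
  move=> XH uH; rewrite -card_coset_preim // -(card_rcoset _ u).
  apply: eq_card => h; rewrite mem_rcoset !inE mulgKV.
  by rewrite groupMr // groupV.
have cardD : (#|H| * #|D| = #|gT| * (#|Q| * #|D0|))%N.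
  rewrite -sum_translate.
  rewrite (eq_bigr (fun=> #|Q| * #|D0|)%N) ?sum_nat_const // => x _.
  rewrite -(card_shift D0 (x * (tau x)^-1)) //; apply: eq_card => h.
  by rewrite !inE; case hH: (h \in H) => //=; rewrite tauH // mulgA.
have card_slice b : b \in B ->
    (#|H| * #|[set x in D | (x * b)%g \notin D]| =
     #|H| * \sum_(t in tau @: [set: gT]) #|Q| * #|[set a in D0 | (a * eta t b)%g \notin D0]|)%N.
  move=> bB; rewrite -sum_translate -sum_tau; apply: eq_bigr => x _.
  rewrite -(card_shift _ (x * (tau x)^-1)) //; last first.
    by apply: subset_trans D0H; apply/subsetP => a; rewrite inE => /andP[].
  apply: eq_card => h; rewrite !inE; case hH: (h \in H) => //=.
  have -> : coset Q (h * (x * (tau x)^-1)) * eta (tau x) b =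
            coset Q (h * x * b * (tau (x * b))^-1).
    by rewrite /eta -morphM // -tauM !mulgA mulgKV.
  by rewrite -[h * x * b]mulgA !(tauH _ hH) !mulgA.
have card_pairs : #|cut_pairs D| = (#|Q| * shift_boundary s D0)%N.
  rewrite card_cut_pairs.
  have H_gt0 : (0 < #|H|)%N := cardG_gt0 H.
  apply/eqP; rewrite -(eqn_pmul2l H_gt0) big_distrr /= (eq_bigr _ card_slice).
  rewrite -big_distrr /= eqn_pmul2l // exchange_big /=; apply/eqP.
  rewrite /shift_boundary big_allpairs_dep big_distrr /= big_enum /=.
  by apply: eq_bigr => t _; rewrite big_distrr /= big_enum.
exists D; split.
- by move=> q x qQ; rewrite memD ?(subsetP QH) // coset_kerl // inE.
- rewrite -(leq_pmul2l (cardG_gt0 H)) [leqRHS]mulnCA cardD cardQ.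
  have := leq_mul D0_big (leqnn (#|Q| * #|gT|)).
  by move: #|H / Q| #|Q| #|gT| #|D0| => a b c d; nia.
- rewrite -(leq_pmul2l (cardG_gt0 H)) mulnCA cardD cardQ.
  have := leq_mul D0_half (leqnn (#|Q| * #|gT|)).
  by move: #|H / Q| #|Q| #|gT| #|D0| => a b c d; nia.
rewrite card_pairs.
have <- : (#|H| * #|[set: gT] : H| = #|gT|)%N by rewrite Lagrange ?subsetT // cardsT.
rewrite cardQ mulnCA [leqRHS](_ : _ = #|Q| * (size s * #|H / Q|))%N.
  by rewrite leq_mul2l bD0 orbT.
by rewrite size_s; move: #|H / Q| #|Q| #|B| #|_ : H| => a b c d; nia.
Qed.

End LiftedCut.

(** * Light sets *)

Section LightSets.
Variables (gT : finGroupType) (Q : {group gT}) (B : {set gT}).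
Hypothesis BV : forall x, x \in B -> x^-1 \in B.
Implicit Types (x y g q : gT) (Y : {set gT}) (p : gT * gT).

Definition adj : rel gT := fun x y => x^-1 * y \in B.

Lemma adj_sym : symmetric adj.
Proof.
by move=> x y; apply/idP/idP => /BV; rewrite invMg invgK.
Qed.

Lemma adjM g x y : adj (g * x) (g * y) = adj x y.
Proof. by rewrite /adj invMg -mulgA mulKg. Qed.

Definition translate g p := (g * p.1, g * p.2).

Definition invariant_under (S : {set gT}) Y := forall q x, q \in S -> (q * x \in Y) = (x \in Y).

Definition equivariant (phi : gT -> gT) :=
  (forall x, phi x \in Q) /\ (forall q x, q \in Q -> phi (q * x) = q * phi x).

(* An equivariant [phi] labels the edge from [x] to [y] by the element
   [(phi x)^-1 * phi y] of [Q], and [P] generates the labels inside [Y]. Counting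
   generators and boundary edges together in [m] makes [m] subadditive. *)
Definition light Y (m : nat) :=
  invariant_under Q Y /\ exists phi, exists P : {set gT},
    [/\ equivariant phi, P \subset Q,
        forall x y, x \in Y -> y \in Y -> adj x y -> (phi x)^-1 * phi y \in <<P>> &
        (#|P| * #|Q| + #|cut_pairs B Y| <= m)%N].

(** The fibre of [psi] through z contains the [#|P|] distinct elements [act q z]. For labels
    invariant under a free action, this turns a count of edges into a count of generators. *)
Lemma card_free_quotient (aT : finType) (P : {group gT}) (act : gT -> aT -> aT)
    (rT : finType) (psi : aT -> rT) (Z : {set aT}) :
  (forall z, injective (act^~ z)) ->
  (forall q z, q \in P -> z \in Z -> act q z \in Z /\ psi (act q z) = psi z) ->
  (#|psi @: Z| * #|P| <= #|Z|)%N.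
Proof.
move=> act_inj invZ; rewrite -[leqRHS]sum1_card.
rewrite (partition_big psi (mem (psi @: Z))) /=; last by move=> z; exact: imset_f.
rewrite -sum_nat_const; apply: leq_sum => _ /imsetP[z zZ ->].
rewrite sum1dep_card -(card_imset P (act_inj z)); apply/subset_leq_card/subsetP => _ /imsetP[q qP ->].
by rewrite inE; have [-> ->] := invZ q z qP zZ; rewrite eqxx.
Qed.

Lemma translate_inj p : injective (translate^~ p).
Proof. by move=> g h [/mulIg]. Qed.

Lemma cut_pairs_translate Y q p : invariant_under Q Y -> q \in Q ->
  (translate q p \in cut_pairs B Y) = (p \in cut_pairs B Y).
Proof. by move=> QY qQ; rewrite !inE /= !QY // -!/(adj _ _) adjM. Qed.

Definition rcoset_ratio (P : {group gT}) x := x * (repr (P :* x))^-1.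

Lemma rcoset_ratio_mem (P : {group gT}) x : rcoset_ratio P x \in P.
Proof. by rewrite -mem_rcoset rcoset_sym mem_repr_rcoset. Qed.

Lemma rcoset_ratioM (P : {group gT}) q x :
  q \in P -> rcoset_ratio P (q * x) = q * rcoset_ratio P x.
Proof. by move=> qP; rewrite /rcoset_ratio rcosetM (rcoset_id qP) mulgA. Qed.

Lemma rcoset_ratio_equivariant : equivariant (rcoset_ratio Q).
Proof. by split=> [x|q x qQ]; [exact: rcoset_ratio_mem | rewrite rcoset_ratioM]. Qed.

Definition increment (phi : gT -> gT) p := (phi p.1)^-1 * phi p.2.

Lemma increment_translate phi q p : equivariant phi -> q \in Q ->
  increment phi (translate q p) = increment phi p.
Proof.
by case=> _ phiM qQ; rewrite /increment /= !phiM // invMg -mulgA mulKg.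
Qed.

Lemma increment_mem phi p : equivariant phi -> increment phi p \in Q.
Proof. by case=> phiQ _; rewrite groupM ?groupV. Qed.

Lemma card_out Y : #|[set p | (p.1 \in Y) && adj p.1 p.2]| = (#|Y| * #|B|)%N.
Proof.
rewrite -cardsX -(card_imset (setX Y B) (_ : injective (fun p => (p.1, p.1 * p.2)))).
  apply: eq_card => -[x y]; rewrite !inE /=; apply/andP/imsetP => [[xY xy]|[[z b]]].
    by exists (x, x^-1 * y); rewrite ?inE /= ?xY ?mulKVg.
  by rewrite inE /= => /andP[zY bB] [-> ->]; rewrite zY /adj mulKg.
by move=> [x y] [z t] /= [-> /mulgI ->].
Qed.

(** Exactly [#|B| * #|Y|] edges start in [Y]. Those ending in [Y] pay for the labels, the others are
    the boundary. *)
Lemma light_trivial Y : invariant_under Q Y -> light Y (#|B| * #|Y|).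
Proof.
move=> QY; split=> //; exists (rcoset_ratio Q).
have phiQ := rcoset_ratio_equivariant; set phi := rcoset_ratio Q.
pose Z := [set p | [&& p.1 \in Y, p.2 \in Y & adj p.1 p.2]].
exists (increment phi @: Z); split=> //.
- by apply/subsetP => _ /imsetP[p _ ->]; exact: increment_mem.
- move=> x y xY yY xy; apply: mem_gen; apply/imsetP; exists (x, y) => //.
  by rewrite inE /= xY yY.
rewrite [leqRHS]mulnC -card_out (leq_trans (leq_add (card_free_quotient (P := Q) translate_inj _) (leqnn _))) //.
  move=> q p qQ; rewrite !inE /= !QY // adjM increment_translate //.
rewrite -cardsUI (_ : _ :&: _ = set0) ?cards0 ?addn0.
  apply/subset_leq_card/subsetP => p; rewrite !inE.
  by case/orP=> /and3P[-> _ xy].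
by apply/setP => p; rewrite !inE; case: (p.2 \in Y); rewrite ?andbF.
Qed.

(** Glue [phi1] on [Y1] with [phi2] elsewhere. The new labels come from the boundary edges of [Y1]
    that end in [Y2]; these leave the boundary of the union, and what they save there pays for their
    labels. *)
Lemma lightU Y1 Y2 m1 m2 : light Y1 m1 -> light Y2 m2 -> light (Y1 :|: Y2) (m1 + m2).
Proof.
move=> [QY1 [phi1 [P1 [eq1 P1Q gen1 card1]]]] [QY2 [phi2 [P2 [eq2 P2Q gen2 card2]]]].
split=> [q x qQ|]; first by rewrite !inE QY1 // QY2.
pose phi x := if x \in Y1 then phi1 x else phi2 x.
have phiQ : equivariant phi.
  case: eq1 eq2 => phiQ1 phiM1 [phiQ2 phiM2].
  by split=> [x|q x qQ]; rewrite /phi ?QY1 //; case: ifP => _ //; rewrite ?phiM1 ?phiM2.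
pose Z := [set p in cut_pairs B Y1 | p.2 \in Y2].
exists phi, (P1 :|: P2 :|: increment phi @: Z); split=> //.
- rewrite !subUset P1Q P2Q; apply/subsetP => _ /imsetP[p _ ->]; exact: increment_mem.
- set P := (X in <<X>>).
  have PZ x y : x \in Y1 -> y \in Y1 :|: Y2 -> y \notin Y1 -> adj x y -> increment phi (x, y) \in <<P>>.
    move=> xY1 yY yY1 xy; apply/mem_gen/setUP; right.
    apply/imsetP; exists (x, y) => //.
    by move: yY xy; rewrite !inE /= xY1 (negPf yY1) /adj => /= -> ->.
  move=> x y xY yY xy; rewrite /phi; case: ifPn => xY1; case: ifPn => yY1.
  + by apply: (subsetP (genS _)) (gen1 x y xY1 yY1 xy); rewrite /P -setUA subsetUl.
  + by have := PZ x y xY1 yY yY1 xy; rewrite /increment /phi /= xY1 (negPf yY1).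
  + have := PZ y x yY1 xY xY1; rewrite adj_sym => /(_ xy) /groupVr.
    by rewrite /increment /phi /= yY1 (negPf xY1) invMg invgK.
  + have xY2 : x \in Y2 by move: xY; rewrite inE (negPf xY1).
    have yY2 : y \in Y2 by move: yY; rewrite inE (negPf yY1).
    by apply: (subsetP (genS _)) (gen2 x y xY2 yY2 xy); rewrite /P setUAC subsetUr.
have cardZ : (#|increment phi @: Z| * #|Q| <= #|Z|)%N.
  apply: card_free_quotient translate_inj _ => q p qQ.
  rewrite inE => /andP[pY1 pY2].
  by rewrite inE cut_pairs_translate // pY1 /= QY2 // pY2 increment_translate.
have cardB : (#|cut_pairs B (Y1 :|: Y2)| + #|Z| <= #|cut_pairs B Y1| + #|cut_pairs B Y2|)%N.
  have ZB1 : cut_pairs B Y1 :&: Z = Z by apply/setIidPr/subsetP => p; rewrite inE => /andP[].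
  rewrite -(cardsID Z (cut_pairs B Y1)) ZB1 addnC -addnA leq_add2l.
  apply: leq_trans _ (leq_card_setU _ _); apply/subset_leq_card/subsetP => p.
  rewrite !inE; case: (p.1 \in Y1) => /=; first by case/andP=> /norP[/negPf-> /negPf->] ->.
  by case/and3P=> -> /norP[_ ->] ->; rewrite ?orbT.
have cardP : (#|P1 :|: P2 :|: increment phi @: Z| <= #|P1| + #|P2| + #|increment phi @: Z|)%N.
  by rewrite (leq_trans (leq_card_setU _ _)) // leq_add2r leq_card_setU.
have := leq_mul cardP (leqnn #|Q|); rewrite !mulnDl; lia.
Qed.

Lemma light0 : light set0 0.
Proof.
have := light_trivial (_ : invariant_under Q set0); rewrite cards0 muln0; apply.
by move=> q x _; rewrite !inE.
Qed.

(** As [Q] is normal, conjugating by [g] the labelling transported by [g] makes it equivariant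
    again. *)
Lemma light_lcoset g Y m : Q <| [set: gT] -> light Y m -> light (g *: Y) m.
Proof.
move=> nQ [QY [phi [P [[phiQ phiM] PQ gen card]]]].
have QJ q h : (q ^ h \in Q) = (q \in Q).
  by rewrite memJ_norm // (subsetP (normal_norm nQ)).
have gJ z : g * z * g^-1 = z ^ g^-1 by rewrite conjgE invgK mulgA.
split=> [q x qQ|].
  by rewrite !mem_lcoset -[RHS](QY (q ^ g)) ?QJ // /conjg !mulgA mulgK.
exists (fun x => g * phi (g^-1 * x) * g^-1), (P :^ g^-1); split.
- split=> [x|q x qQ]; first by rewrite gJ QJ.
  have -> : g^-1 * (q * x) = q ^ g * (g^-1 * x) by rewrite /conjg !mulgA mulgK.
  by rewrite phiM ?QJ // /conjg !mulgA mulgV mul1g.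
- by rewrite sub_conjgV; apply: subset_trans PQ _; apply/subsetP => q; rewrite mem_conjg QJ.
- move=> x y; rewrite !mem_lcoset => xY yY xy.
  have -> : (g * phi (g^-1 * x) * g^-1)^-1 * (g * phi (g^-1 * y) * g^-1) =
            ((phi (g^-1 * x))^-1 * phi (g^-1 * y)) ^ g^-1.
    by rewrite /conjg !invMg !invgK !mulgA mulgKV.
  by rewrite genJ memJ_conjg gen // adjM.
rewrite cardJg (leq_trans _ card) // leq_add2l.
rewrite -(card_imset (mem (cut_pairs B Y)) (_ : injective (translate g))).
  apply/subset_leq_card/subsetP => p; rewrite !inE !mem_lcoset => pY.
  apply/imsetP; exists (translate g^-1 p); last by case: p {pY} => x y; rewrite /translate /= !mulKVg.
  by rewrite !inE /= -/(adj _ _) adjM.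
by move=> [x y] [z t] [/mulgI-> /mulgI->].
Qed.

Hypothesis conn : forall x y, connect adj x y.

Lemma closed_setT (Z : {set gT}) z :
  z \in Z -> (forall x y, x \in Z -> adj x y -> y \in Z) -> forall x, x \in Z.
Proof.
move=> zZ Zadj x; have Zcl : closed adj (mem Z).
  by apply: (intro_closed (sym_connect_sym adj_sym)) => a b ab aZ; exact: Zadj ab.
by rewrite -(closed_connect Zcl (conn z x)).
Qed.

(** The graph is connected, so the labels generate every (phi 1)^-1 phi x. By equivariance each q in
    [Q] has this form, with x = phi 1 * q * (phi 1)^-1. *)
Lemma light_setT_gen m : light [set: gT] m ->
  exists P : {set gT}, <<P>> = Q /\ (#|P| * #|Q| <= m)%N.
Proof.
case=> _ [phi [P [[phiQ phiM] PQ gen card]]]; exists P; split; last first.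
  exact: leq_trans (leq_addr _ _) card.
apply/eqP; rewrite eqEsubset gen_subG PQ /=; apply/subsetP => q qQ.
have incr x : (phi 1)^-1 * phi x \in <<P>>.
  suff : x \in [set x | (phi 1)^-1 * phi x \in <<P>>] by rewrite inE.
  apply: (@closed_setT _ 1) => [|y z]; first by rewrite inE mulVg group1.
  rewrite !inE => yP yz; rewrite -[phi z](mulKVg (phi y)) mulgA groupM //.
  by rewrite gen ?inE.
have phi_mem h : h \in Q -> phi h = h * phi 1 by move=> hQ; rewrite -{1}[h]mulg1 phiM.
have hQ : phi 1 * q * (phi 1)^-1 \in Q by rewrite !groupM ?groupV.
have := incr (phi 1 * q * (phi 1)^-1); rewrite (phi_mem _ hQ) mulgKV mulKg; exact.
Qed.

End LightSets.

(** * Counting components *)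

Section ComponentCount.
Variable T : finType.
Implicit Types r : rel T.

Definition components r : {set T} := [set root r x | x : T].

Lemma card_components_ltn r r' x y : connect_sym r -> connect_sym r' ->
  subrel r r' -> r' x y -> ~~ connect r x y ->
  (#|components r'| < #|components r|)%N.
Proof.
move=> sr sr' rr' r'xy nxy.
have rootr' z : root r' (root r z) = root r' z.
  by apply/eqP; rewrite root_connect // sr'; apply: (connect_sub _ (connect_root r z)) => a b ab; exact/connect1/rr'.
have -> : components r' = root r' @: (components r :\ root r x).
  apply/setP => z; apply/imsetP/imsetP => [[t _ ->]|[t _ ->]]; last by exists t.
  have [tx|tx] := eqVneq (root r t) (root r x).
    exists (root r y); last first.
      rewrite rootr' -(rootr' t) tx rootr'; apply/eqP; rewrite root_connect //; exact: connect1.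
    by rewrite !inE imset_f // andbT root_connect // sr.
  by exists (root r t); rewrite ?rootr' // !inE tx imset_f.
rewrite (leq_ltn_trans (leq_imset_card _ _)) // [ltnRHS](cardsD1 (root r x)).
by rewrite imset_f.
Qed.

Lemma card_components_gt0 r (x : T) : (0 < #|components r|)%N.
Proof. by rewrite card_gt0; apply/set0Pn; exists (root r x); rewrite imset_f. Qed.

(* Each new label merges two components, so a spanning set of labels is
   smaller than the number of components. *)
Lemma spanning_labels (U : finType) (I : {set U}) (r : {set U} -> rel T) (x0 : T) :
  (forall F, symmetric (r F)) ->
  (forall F F' : {set U}, F \subset F' -> subrel (r F) (r F')) ->
  (forall F x y, r I x y -> exists2 l, l \in I & r (l |: F) x y) ->
  (forall x y, connect (r I) x y) ->
  exists F : {set U}, [/\ F \subset I, (#|F| < #|components (r set0)|)%N &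
    forall x y, connect (r F) x y].
Proof.
move=> rsym rmono radd rconn.
have csym F : connect_sym (r F) := sym_connect_sym (rsym F).
pose P (F : {set U}) := (F \subset I) && (#|F| + #|components (r F)| <= #|components (r set0)|)%N.
have P0 : P set0 by rewrite /P sub0set cards0 leqnn.
case: (@arg_maxnP _ set0 P (fun F => #|F|) P0) => F /andP[FI cardF] maxF.
have adjF x y : r I x y -> connect (r F) x y.
  move=> rxy; apply/contraT => nxy; have [l lI rlxy] := radd F x y rxy.
  have lF : l \notin F.
    by apply: contraNN nxy => lF; apply: connect1; move: rlxy; rewrite (setUidPr _) // sub1set.
  have := card_components_ltn (csym F) (csym _) (rmono _ _ (subsetUr [set l] F)) rlxy nxy.
  suff : P (l |: F) -> False.
    move=> nP lt; case: nP; rewrite /P subUset sub1set lI FI cardsU1 lF /=; lia.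
  by move=> /maxF; rewrite /= cardsU1 lF; lia.
exists F; split=> // [|x y].
  by have := card_components_gt0 (r F) x0; lia.
by apply: connect_sub (rconn x y).
Qed.

End ComponentCount.

(** * Stabilisers of connected components *)

Section ComponentStabiliser.
Variables (gT : finGroupType) (Q : {group gT}) (T : finType).
Variables (act : gT -> T -> T) (r : rel T).
Hypothesis act1 : forall z, act 1 z = z.
Hypothesis actM : forall g h z, act (g * h) z = act g (act h z).
Hypothesis r_sym : symmetric r.
Hypothesis r_act : forall q x y, q \in Q -> r (act q x) (act q y) = r x y.

Let csym : connect_sym r := sym_connect_sym r_sym.

Lemma connect_act q x y : q \in Q -> connect r (act q x) (act q y) = connect r x y.
Proof.
have le g a b : g \in Q -> connect r a b -> connect r (act g a) (act g b).
  move=> gQ /connectP[p]; elim: p a => [|c p IHp] a /=; first by move=> _ ->.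
  by move=> /andP[ac cp] eb; apply: connect_trans (IHp c cp eb); rewrite connect1 ?r_act.
move=> qQ; apply/idP/idP; last exact: le.
by move=> /(le q^-1); rewrite groupV -!actM mulVg !act1; exact.
Qed.

(** The setwise stabiliser in [Q] of the component of [z], not of the point [z]. *)
Definition stabiliser z := [set q in Q | connect r z (act q z)].

Lemma stabiliser_group_set z : group_set (stabiliser z).
Proof.
apply/group_setP; split=> [|a b]; first by rewrite inE group1 act1 connect0.
rewrite !inE => /andP[aQ az] /andP[bQ bz]; rewrite groupM //=.
by apply: connect_trans az _; rewrite actM connect_act.
Qed.
Canonical stabiliser_group z := Group (stabiliser_group_set z).

Lemma stabiliser_sub z : stabiliser z \subset Q.
Proof. by apply/subsetP => q; rewrite inE => /andP[]. Qed.

Lemma stabiliser_ratio z a b : a \in Q -> b \in Q ->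
  (a^-1 * b \in stabiliser z) = connect r (act a z) (act b z).
Proof.
by move=> aQ bQ; rewrite inE groupM ?groupV //= -(connect_act _ _ aQ) -actM mulKVg.
Qed.

(** Orbit-stabiliser theorem for the action on components, each named by its root. *)
Lemma card_orbit_components z :
  #|[set root r (act q z) | q in Q]| = #|Q : stabiliser z|.
Proof.
rewrite -card_lcosets.
pose f (C : {set gT}) := root r (act (repr C) z).
have fE q : q \in Q -> f (q *: stabiliser z) = root r (act q z).
  move=> qQ; have : repr (q *: stabiliser z) \in q *: stabiliser z.
    by apply: (mem_repr q); rewrite lcoset_refl.
  rewrite mem_lcoset => sq.
  have aQ : repr (q *: stabiliser z) \in Q.
    by rewrite -(mulKVg q (repr _)) groupM // (subsetP (stabiliser_sub z)).
  by apply/eqP; rewrite root_connect // csym -stabiliser_ratio.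
rewrite -(card_in_imset (f := f)); last first.
  move=> _ _ /lcosetsP[a aQ ->] /lcosetsP[b bQ ->]; rewrite !fE //.
  move/eqP; rewrite root_connect // -stabiliser_ratio // => ab.
  by apply/lcoset_eqP; rewrite mem_lcoset -groupV invMg invgK.
apply: eq_card => u; apply/imsetP/imsetP => [[q qQ ->]|[_ /lcosetsP[q qQ ->] ->]].
  by exists (q *: stabiliser z); rewrite ?fE //; apply/lcosetsP; exists q.
by exists q; rewrite ?fE.
Qed.

End ComponentStabiliser.

(** * Classes of cut pairs *)

Section CutClasses.
Variables (gT : finGroupType) (Q : {group gT}) (B : {set gT}).
Hypothesis BV : forall x, x \in B -> x^-1 \in B.
Hypothesis conn : forall x y, connect (adj B) x y.
Variable D : {set gT}.
Hypothesis QD : invariant_under Q D.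
Implicit Types (x y w q : gT) (p : gT * gT).

Notation adj := (adj B).
Notation E := (cut_pairs B D).

Let adj_sym := adj_sym BV.

Lemma cut_pairsE x y : ((x, y) \in E) = [&& x \in D, y \notin D & adj x y].
Proof. by rewrite inE. Qed.

(* Two edges across the cut lie in a common triangle exactly when they share an
   endpoint and their other endpoints are adjacent. *)
Definition slide : rel (gT * gT) := fun p p' =>
  [&& p \in E, p' \in E &
      (p.1 == p'.1) && adj p.2 p'.2 || (p.2 == p'.2) && adj p.1 p'.1].

Lemma slide_sym : symmetric slide.
Proof.
by move=> p p'; rewrite /slide ![adj _ p.2]adj_sym ![adj _ p.1]adj_sym
  [p.1 == _]eq_sym [p.2 == _]eq_sym andbCA.
Qed.

Lemma slide_translate q p p' : q \in Q ->
  slide (translate q p) (translate q p') = slide p p'.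
Proof.
move=> qQ; rewrite /slide !(cut_pairs_translate _ _ QD qQ) /translate /= !adjM.
by rewrite !(inj_eq (mulgI q)).
Qed.

Let translate1 p : translate 1 p = p.
Proof. by case: p => x y; rewrite /translate !mul1g. Qed.

Let translateM g h p : translate (g * h) p = translate g (translate h p).
Proof. by rewrite /translate !mulgA. Qed.

Lemma connect_slide_translate q p p' : q \in Q ->
  connect slide (translate q p) (translate q p') = connect slide p p'.
Proof.
by move=> qQ; rewrite (connect_act translate1 translateM (@slide_translate)).
Qed.

Lemma connect_slide_sym : connect_sym slide.
Proof. exact: sym_connect_sym slide_sym. Qed.

Lemma connect_slide_cut p p' : p \in E -> connect slide p p' -> p' \in E.
Proof.
move=> pE /connectP[s]; elim: s p pE => [|a s IHs] p pE /=; first by move=> _ ->.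
by case/andP=> /and3P[_ aE _]; exact: IHs.
Qed.

Definition same_side : rel gT := fun x y => adj x y && ((x \in D) == (y \in D)).

Lemma same_side_sym : symmetric same_side.
Proof. by move=> x y; rewrite /same_side adj_sym eq_sym. Qed.

Lemma same_side_translate q x y : q \in Q -> same_side (q * x) (q * y) = same_side x y.
Proof. by move=> qQ; rewrite /same_side adjM !QD. Qed.

(** A slide fixes one end of the edge and moves the other to an adjacent vertex on its own side of
    the cut. Hence a class determines a component at each end, and its stabiliser fixes both. *)
Lemma connect_slide_same_side p p' : connect slide p p' ->
  connect same_side p.1 p'.1 && connect same_side p.2 p'.2.
Proof.
case/connectP=> s; elim: s p => [|a s IHs] p /=; first by move=> _ ->; rewrite !connect0.
case/andP=> /and3P[]; case: p a => [x y] [z t]; rewrite !cut_pairsE /=.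
move=> /and3P[xD yD _] /and3P[zD tD _] adjs zs def_p'.
have /andP[c1 c2] := IHs _ zs def_p'.
case/orP: adjs => /andP[/eqP-> st].
  rewrite c1; apply: connect_trans c2; apply: connect1.
  by rewrite /same_side st (negPf yD) (negPf tD).
rewrite c2 andbT; apply: connect_trans c1; apply: connect1.
by rewrite /same_side st xD zD.
Qed.

Definition delete (L : {set gT * gT}) : rel gT :=
  fun x y => [&& adj x y, (x, y) \notin L & (y, x) \notin L].

Lemma delete_sym L : symmetric (delete L).
Proof. by move=> x y; rewrite /delete adj_sym; congr (_ && _); exact: andbC. Qed.

Lemma delete_mono (L L' : {set gT * gT}) : L' \subset L -> subrel (delete L) (delete L').
Proof.
move=> sL x y /and3P[xy xL yL]; apply/and3P; split=> //.
  by apply: contraNN xL; apply: (subsetP sL).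
by apply: contraNN yL; apply: (subsetP sL).
Qed.

Lemma same_side_delete (L : {set gT * gT}) : L \subset E -> subrel same_side (delete L).
Proof.
move=> LE x y /andP[xy /eqP xDy]; apply/and3P; split=> //;
  by apply/negP => /(subsetP LE); rewrite cut_pairsE xDy; case: (_ \in D).
Qed.

(** The union of the [Q]-translates of the class of [p], still a set of edges. *)
Definition orbit_class p := [set p' | [exists q in Q, connect slide (translate q p) p']].

Lemma orbit_classP p p' :
  reflect (exists2 q, q \in Q & connect slide (translate q p) p') (p' \in orbit_class p).
Proof. by rewrite inE; exact: exists_inP. Qed.

Lemma orbit_class_refl p : p \in orbit_class p.
Proof. by apply/orbit_classP; exists 1; rewrite ?translate1. Qed.

Lemma orbit_class_translate q p p' : q \in Q ->
  (translate q p' \in orbit_class p) = (p' \in orbit_class p).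
Proof.
have le a b : a \in Q -> b \in orbit_class p -> translate a b \in orbit_class p.
  move=> aQ /orbit_classP[c cQ cb]; apply/orbit_classP; exists (a * c); rewrite ?groupM //.
  by rewrite translateM connect_slide_translate.
move=> qQ; apply/idP/idP; last exact: le.
by move/(le q^-1); rewrite groupV -translateM mulVg translate1; exact.
Qed.

Lemma orbit_class_connect p a b : connect slide a b ->
  (a \in orbit_class p) = (b \in orbit_class p).
Proof.
move=> ab; apply/orbit_classP/orbit_classP => -[q qQ qp]; exists q => //.
  exact: connect_trans qp ab.
by apply: connect_trans qp _; rewrite connect_slide_sym.
Qed.

Lemma orbit_class_sub p : p \in E -> orbit_class p \subset E.
Proof.
move=> pE; apply/subsetP => p' /orbit_classP[q qQ]; apply: connect_slide_cut.
by rewrite (cut_pairs_translate _ _ QD qQ).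
Qed.

Lemma orbit_class_eq p p' : p' \in orbit_class p -> orbit_class p' = orbit_class p.
Proof.
case/orbit_classP=> q qQ qp; apply/setP => a; apply/idP/idP.
  case/orbit_classP=> g gQ ga; rewrite -(orbit_class_connect _ ga) orbit_class_translate //.
  by rewrite -(orbit_class_connect _ qp) orbit_class_translate // orbit_class_refl.
case/orbit_classP=> g gQ ga; rewrite -(orbit_class_connect _ ga) orbit_class_translate //.
by rewrite -(orbit_class_translate _ _ qQ) (orbit_class_connect _ qp) orbit_class_refl.
Qed.

Section OneClass.
Variables v v' : gT.
Hypothesis p0E : (v, v') \in E.
Let p0 := (v, v').
Let O := orbit_class p0.
Let r0 := delete O.

Let OE : O \subset E.
Proof. exact: orbit_class_sub. Qed.

Let r0_sym : symmetric r0.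
Proof. exact: delete_sym. Qed.

Let r0_conn_sym : connect_sym r0.
Proof. exact: sym_connect_sym r0_sym. Qed.

Let r0_translate q x y : q \in Q -> r0 (q * x) (q * y) = r0 x y.
Proof.
move=> qQ; rewrite /r0 /delete adjM.
by rewrite -![(q * _, q * _)]/(translate q (_, _)) !orbit_class_translate.
Qed.

Let connect_r0_translate q x y : q \in Q -> connect r0 (q * x) (q * y) = connect r0 x y.
Proof. by move=> qQ; rewrite (connect_act (@mul1g _) (fun g h z => esym (mulgA g h z)) r0_translate). Qed.

Definition class_stabiliser : {group gT} :=
  stabiliser_group translate1 translateM slide_translate p0.

Definition side_stabiliser w : {group gT} :=
  stabiliser_group (@mul1g gT) (fun g h z => esym (mulgA g h z)) r0_translate w.

Lemma same_side_r0 x y : connect same_side x y -> connect r0 x y.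
Proof. by apply: connect_sub => a b ab; apply/connect1/same_side_delete. Qed.

Lemma orbit_class_ends x y : (x, y) \in O ->
  exists2 q, q \in Q & connect r0 (q * v) x && connect r0 (q * v') y.
Proof.
case/orbit_classP=> q qQ /connect_slide_same_side /andP[c1 c2].
by exists q; rewrite ?same_side_r0.
Qed.

Lemma class_stabiliser_sub : class_stabiliser \subset side_stabiliser v :&: side_stabiliser v'.
Proof.
apply/subsetP => q; rewrite 3!inE => /andP[qQ /connect_slide_same_side /andP[c1 c2]].
by rewrite !inE qQ !same_side_r0.
Qed.

(** Walk from [v] in the connected Cayley graph: each edge of [O] that is crossed leads into a
    translate of the component of [v] or of [v'], and other edges stay within a component. *)
Lemma near_orbit x : exists2 q, q \in Q & connect r0 (q * v) x || connect r0 (q * v') x.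
Proof.
apply/exists_inP.
pose Z := [set x | [exists q in Q, connect r0 (q * v) x || connect r0 (q * v') x]].
suff : x \in Z by rewrite inE.
apply: (closed_setT BV conn (z := v)) => [|a b].
  by rewrite inE; apply/exists_inP; exists 1; rewrite ?mul1g ?connect0.
rewrite !inE => /exists_inP[q qQ qa] ab; apply/exists_inP.
have [abO|abO] := boolP ((a, b) \in O).
  by have [g gQ /andP[_ gb]] := orbit_class_ends abO; exists g; rewrite ?gb ?orbT.
have [baO|baO] := boolP ((b, a) \in O).
  by have [g gQ /andP[gb _]] := orbit_class_ends baO; exists g; rewrite ?gb ?orbT.
have r0ab : connect r0 a b by apply: connect1; rewrite /r0 /delete ab abO.
exists q => //; by case/orP: qa => qa; rewrite (connect_trans qa r0ab) ?orbT.
Qed.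

Let labels : {set gT * gT} := [set root slide (translate q p0) | q in Q].

Let card_labels : #|labels| = #|Q : class_stabiliser|.
Proof. by rewrite -(card_orbit_components translate1 translateM slide_sym (@slide_translate)). Qed.

Let root_label p : p \in O -> root slide p \in labels.
Proof.
case/orbit_classP=> q qQ qp; apply/imsetP; exists q; first exact: qQ.
by apply/eqP; rewrite (root_connect connect_slide_sym) connect_slide_sym.
Qed.

Let label_orbit l : l \in labels -> l \in O.
Proof.
case/imsetP=> q qQ ->; apply/orbit_classP; exists q => //; exact: connect_root.
Qed.

Let root_labels l : l \in labels -> root slide l = l.
Proof. by case/imsetP=> q _ ->; rewrite root_root //; exact: connect_slide_sym. Qed.

Lemma card_components_r0 :
  (#|components r0| <= #|Q : side_stabiliser v| + #|Q : side_stabiliser v'|)%N.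
Proof.
rewrite -!(card_orbit_components (@mul1g gT) (fun g h z => esym (mulgA g h z)) r0_sym r0_translate).
apply: leq_trans _ (leq_card_setU _ _); apply/subset_leq_card/subsetP => _ /imsetP[x _ ->].
have [q qQ qx] := near_orbit x; apply/setUP; case/orP: qx => qx; [left|right];
  apply/imsetP; (exists q; first exact: qQ); apply/eqP;
  by rewrite (root_connect r0_conn_sym) r0_conn_sym.
Qed.

Definition slide_class p := [set p' | connect slide p p'].

(* The translates of the class are the edges, and the components of [r0] the
   vertices, of a connected graph. It has [#|Q : class_stabiliser|] edges and at
   most two thirds as many vertices, so a spanning tree omits two edges. *)
Lemma separating_pair :
  (3 * #|class_stabiliser| <= #|side_stabiliser v|)%N ->
  (3 * #|class_stabiliser| <= #|side_stabiliser v'|)%N ->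
  exists p1 p2, [/\ p1 \in E, p2 \in E, ~~ connect slide p1 p2 &
    forall x y, connect (delete (slide_class p1 :|: slide_class p2)) x y].
Proof.
move=> le_v le_v'.
(* [F] is the set of classes put back: [r set0] is [r0], and [r labels] is the whole graph. *)
pose removed (F : {set gT * gT}) := [set p in O | root slide p \notin F].
have removedE F p : (p \in removed F) = (p \in O) && (root slide p \notin F).
  by rewrite in_set.
pose r F := delete (removed F).
have [||||F [FI cardF connF]] := @spanning_labels gT _ labels r v.
- by move=> F; exact: delete_sym.
- move=> F F' sF; apply: delete_mono; apply/subsetP => p; rewrite !removedE.
  by case/andP=> -> /=; apply: contraNN; apply: (subsetP sF).
- move=> F x y /and3P[xy _ _].
  have [xyO|xyO] := boolP ((x, y) \in O).
    exists (root slide (x, y)); first exact: root_label.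
    have yxO : (y, x) \notin O.
      apply/negP => /(subsetP OE); have := subsetP OE _ xyO; rewrite !cut_pairsE.
      by case: (x \in D); rewrite ?andbF.
    by rewrite /r /delete xy !removedE (negPf yxO) setU11 andbF.
  have [yxO|yxO] := boolP ((y, x) \in O).
    exists (root slide (y, x)); first exact: root_label.
    by rewrite /r /delete xy !removedE (negPf xyO) setU11 andbF.
  exists (root slide p0); first by apply: root_label; exact: orbit_class_refl.
  by rewrite /r /delete xy !removedE (negPf xyO) (negPf yxO).
- move=> x y; apply: connect_sub (conn x y) => a b ab; apply: connect1.
  rewrite /r /delete ab !removedE andTb.
  by apply/andP; split; apply/negP => /andP[/root_label lI]; rewrite lI.
(* With i = [Q : C], C being [class_stabiliser], both side stabilisers have index at most i / 3. So
   there are at most 2 i / 3 components and [#|F|] is at most 2 i / 3 - 1, which leaves more than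
   one of the i labels. *)
have lt2 : (1 < #|labels :\: F|)%N.
  have r00 : components (r set0) = components r0.
    congr (components (delete _)); apply/setP => p.
    by rewrite removedE in_set0 andbT.
  have := card_components_r0; rewrite -r00.
  have := cardsID F labels; rewrite (setIidPr FI) card_labels.
  have := Lagrange (stabiliser_sub _ _ _ _ : class_stabiliser \subset Q).
  have := Lagrange (stabiliser_sub _ _ _ _ : side_stabiliser v \subset Q).
  have := Lagrange (stabiliser_sub _ _ _ _ : side_stabiliser v' \subset Q).
  have := cardG_gt0 class_stabiliser; have := cardG_gt0 Q.
  move: cardF le_v le_v'; move: #|Q : class_stabiliser| #|Q : side_stabiliser v| #|Q : side_stabiliser v'|.
  move: #|class_stabiliser| #|side_stabiliser v| #|side_stabiliser v'| #|Q| #|F| #|_ :\: F| #|components _|.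
  move=> c s s' n f d m i j j' lt_f le_s le_s' n_gt0 c_gt0 es' es ei ed le_m.
  have : (3 * j <= i)%N by nia.
  have : (3 * j' <= i)%N by nia.
  by lia.
have /card_gt1P[l1 [l2 [/setDP[l1I l1F] /setDP[l2I l2F] l12]]] := lt2.
exists l1, l2; split.
- by apply: (subsetP OE); exact: label_orbit.
- by apply: (subsetP OE); exact: label_orbit.
- by rewrite -(root_connect connect_slide_sym) !root_labels.
move=> x y; apply: connect_sub (connF x y) => a b; move/delete_mono => sub; apply/connect1/sub.
apply/subsetP => p; rewrite removedE in_setU !(in_set (connect slide _)).
have cls l : l \in labels -> l \notin F -> connect slide l p -> (p \in O) && (root slide p \notin F).
  move=> lI lF lp; rewrite -(orbit_class_connect _ lp) label_orbit //=.
  by move: lp; rewrite -(root_connect connect_slide_sym) root_labels // => /eqP <-.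
by case/orP; apply: cls.
Qed.

(** [O] is the disjoint union of [Q : C] translates of the class, where C is [class_stabiliser]. *)
Let card_slide_class : (#|slide_class p0| * #|Q| <= #|O| * #|class_stabiliser|)%N.
Proof.
rewrite -(Lagrange (stabiliser_sub _ _ _ _ : class_stabiliser \subset Q)).
rewrite mulnCA [leqRHS]mulnC leq_mul2l; apply/orP; right.
rewrite mulnC -card_labels -[leqRHS]sum1_card.
rewrite (partition_big (root slide) (mem labels)) /=; last exact: root_label.
rewrite -sum_nat_const; apply: leq_sum => _ /imsetP[q qQ ->].
rewrite sum1dep_card -(card_imset (mem (slide_class p0)) (_ : injective (translate q))); last first.
  by move=> [x y] [z t] [/mulgI-> /mulgI->].
apply/subset_leq_card/subsetP => _ /imsetP[p pp ->].
have {}pp : connect slide p0 p by move: pp; rewrite inE.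
rewrite inE orbit_class_translate // -(orbit_class_connect _ pp) orbit_class_refl.
by rewrite (root_connect connect_slide_sym) connect_slide_sym connect_slide_translate.
Qed.

Let card_slide_out p : (#|[set p' | slide p p']| <= 2 * #|B|)%N.
Proof.
pose f1 b := (p.1, p.2 * b); pose f2 b := (p.1 * b, p.2).
apply: leq_trans (_ : #|f1 @: B :|: f2 @: B| <= _)%N.
  apply/subset_leq_card/subsetP => -[x y]; rewrite !inE => /and3P[_ _ /=].
  case/orP=> /andP[/eqP<- ab]; apply/orP; [left|right]; apply/imsetP.
    by exists (p.2^-1 * y); rewrite /f1 ?mulKVg.
  by exists (p.1^-1 * x); rewrite /f2 ?mulKVg.
rewrite (leq_trans (leq_card_setU _ _)) // mul2n -addnn.
by rewrite leq_add ?leq_imset_card.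
Qed.

(** The argument of [light_setT_gen] on the slide graph of the class, which is connected and on
    which the stabiliser acts freely: the increments of [phi] along slides generate, and there are
    at most [2 * #|B|] slides at each edge. *)
Lemma class_generators : exists P : {set gT},
  <<P>> = class_stabiliser /\ (#|P| * #|Q| <= 2 * #|B| * #|O|)%N.
Proof.
set C := class_stabiliser.
pose phi p := rcoset_ratio C p.1; pose incr pp := (phi pp.1)^-1 * phi pp.2.
pose Z := [set pp | (pp.1 \in slide_class p0) && slide pp.1 pp.2].
pose act q (pp : _ * _) := (translate q pp.1, translate q pp.2).
have phiC p : phi p \in C by exact: rcoset_ratio_mem.
have phiM q p : q \in C -> phi (translate q p) = q * phi p.
  by move=> qC; rewrite /phi rcoset_ratioM.
have C_Q q : q \in C -> q \in Q by apply: (subsetP (stabiliser_sub _ _ _ _)).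
have C_slide q p : q \in C -> connect slide p0 (translate q p) = connect slide p0 p.
  move=> qC; have := qC; rewrite inE => /andP[qQ qp].
  by rewrite (same_connect connect_slide_sym qp) connect_slide_translate.
exists (incr @: Z); split.
  apply/eqP; rewrite eqEsubset gen_subG; apply/andP; split.
    by apply/subsetP => _ /imsetP[pp _ ->]; apply: groupM; rewrite ?groupV phiC.
  have reach p : connect slide p0 p -> incr (p0, p) \in <<incr @: Z>>.
    case/connectP=> s; elim/last_ind: s p => [|s a IHs] p /=.
      by move=> _ ->; rewrite /incr mulVg group1.
    rewrite rcons_path last_rcons => /andP[ps sa] ->.
    have -> : incr (p0, a) = incr (p0, last p0 s) * incr (last p0 s, a).
      by rewrite /incr /= -[RHS]mulgA mulKVg.
    rewrite groupM ?IHs // mem_gen //; apply/imsetP; exists (last p0 s, a) => //.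
    by rewrite !inE /= sa andbT; apply/connectP; exists s.
  apply/subsetP => q qC; set h := phi p0 * q * (phi p0)^-1.
  have hC : h \in C by rewrite (groupM (groupM (phiC p0) qC)) // groupV phiC.
  have := reach (translate h p0); rewrite C_slide // connect0 => /(_ isT).
  by rewrite /incr /= phiM // /h mulgKV mulKg.
have cardP : (#|incr @: Z| * #|C| <= #|Z|)%N.
  apply: (card_free_quotient (act := act)) => [z g h [/mulIg]//|q [a b] qC].
  rewrite !inE /= => /andP[pa ab]; rewrite C_slide // pa slide_translate ?C_Q //.
  by split=> //; rewrite /incr /= !phiM // invMg -mulgA mulKg.
have cardZ : (#|Z| <= 2 * #|B| * #|slide_class p0|)%N.
  rewrite -sum1_card (partition_big (fun pp => pp.1) (mem (slide_class p0))) /=; last first.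
    by move=> pp; rewrite inE => /andP[].
  rewrite mulnC -sum_nat_const; apply: leq_sum => p pp; rewrite sum1dep_card.
  apply: leq_trans (card_slide_out p).
  rewrite -[leqRHS](card_imset _ (_ : injective (pair p))); last by move=> a b [].
  apply/subset_leq_card/subsetP => -[a b]; rewrite 2!inE => /andP[/andP[_ ab] /eqP eq_a].
  by apply/imsetP; exists b; [rewrite inE -eq_a | rewrite -eq_a].
rewrite -(leq_pmul2r (cardG_gt0 C)) mulnAC (leq_trans (leq_mul cardP (leqnn _))) //.
rewrite (leq_trans (leq_mul cardZ (leqnn _))) // -!mulnA !leq_mul2l.
by rewrite card_slide_class !orbT.
Qed.

Let edge_ends w w' x y : (w, w') = (v, v') \/ (w, w') = (v', v) ->
  adj x y -> ~~ r0 x y -> exists2 q, q \in Q &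
    connect r0 (q * w) x && connect r0 (q * w') y ||
    connect r0 (q * w') x && connect r0 (q * w) y.
Proof.
move=> ends xy; rewrite /r0 /delete xy /= negb_and !negbK.
case/orP=> /orbit_class_ends[q qQ /andP[q1 q2]]; exists q => //.
  by case: ends => -[-> ->]; rewrite q1 q2 ?orbT.
by case: ends => -[-> ->]; rewrite q1 q2 ?orbT.
Qed.

(** [O] orients edges out of [D]. Reorienting the boundary edges of [Y] in this way is injective,
    since no edge leaves [Y] in both directions. *)
Lemma cut_pairs_orbit_class (Y : {set gT}) :
  (forall x y, x \in Y -> y \notin Y -> adj x y -> ((x, y) \in O) || ((y, x) \in O)) ->
  (#|cut_pairs B Y| <= #|O|)%N.
Proof.
move=> bdY; pose f p := if p \in O then p else (p.2, p.1).
rewrite -[leqLHS](card_in_imset (f := f)).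
  apply/subset_leq_card/subsetP => _ /imsetP[[x y] xyY ->]; rewrite /f.
  case: ifPn => // xyO; move: xyY; rewrite inE => /and3P[xY yY xy] /=.
  by have := bdY x y xY yY xy; rewrite (negPf xyO).
move=> [x y] [z t]; rewrite !inE /= => /and3P[xY yY _] /and3P[zY tY _]; rewrite /f.
case: ifP => _; case: ifP => _ //= [e1 e2].
- by rewrite e1 (negPf tY) in xY.
- by rewrite e1 (negPf yY) in zY || by rewrite -e1 (negPf yY) in zY.
by rewrite e1 e2.
Qed.

(** If t lies in [S] but not in [C], the group generated by t and [C] is at least twice as large as
    [C], hence has index below 3 / 2 in [S]. *)
Lemma one_more_generator (C S : {group gT}) : C \subset S -> (#|S| < 3 * #|C|)%N ->
  exists2 t, t \in S & S :=: <<t |: C>>.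
Proof.
move=> CS lt3; have [SC|] := boolP (S \subset C).
  exists 1; first exact: group1.
  have -> : S :=: C by apply/eqP; rewrite eqEsubset SC.
  by rewrite (setUidPr _) ?sub1set ?group1 // genGid.
case/subsetPn=> t tS tC; exists t => //.
have KS : <<t |: C>> \subset S by rewrite gen_subG subUset sub1set tS.
have CK : C \subset <<t |: C>> by rewrite (subset_trans _ (subset_gen _)) ?subsetUr.
have tK : t \in <<t |: C>> by rewrite mem_gen ?setU11.
have lt_CK : (1 < #|<<t |: C>> : C|)%N.
  rewrite indexg_gt1; apply/subsetPn; exists t; rewrite ?tK //.
have eC := Lagrange CK; have eS := Lagrange KS; have S_gt0 := cardG_gt0 S; have C_gt0 := cardG_gt0 C.
have : (#|S : <<t |: C>>| <= 1)%N.
  have K2 : (2 * #|C| <= #|<<t |: C>>|)%N by rewrite -eC mulnC leq_mul2l lt_CK orbT.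
  rewrite leqNgt; apply/negP => lt1; have := leq_mul lt1 K2.
  by rewrite [X in (_ <= X)%N]mulnC eS mulnA => /leq_ltn_trans/(_ lt3); rewrite ltn_pmul2r.
by rewrite leqNgt indexg_gt1 negbK => SK; apply/eqP; rewrite eqEsubset SK.
Qed.

(* When some [t] in [Q] carries the component of [w] to that of [w'] (the HNN
   case), the whole group is light, with [t] as an additional generator;
   otherwise (the amalgam case) the orbit of the component of [w] is. *)
Lemma light_side w w' : (w, w') = (v, v') \/ (w, w') = (v', v) ->
  (#|side_stabiliser w| < 3 * #|class_stabiliser|)%N ->
  exists Y, [/\ light Q B Y ((2 * #|B| + 3) * #|O|),
    forall x y, x \in Y -> y \notin Y -> adj x y -> ((x, y) \in O) || ((y, x) \in O) &
    forall x y, (x, y) \in O -> (x \in Y) || (y \in Y)].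
Proof.
move=> ends lt3; set S := side_stabiliser w in lt3; set C := class_stabiliser in lt3.
have [P [genP cardP]] := class_generators; rewrite -/C in genP.
have CS : C \subset S.
  have := class_stabiliser_sub; rewrite subsetI => /andP[Cv Cv'].
  by case: ends => -[e _]; rewrite /S e.
have [s sS def_S] := one_more_generator CS lt3.
have {}def_S : S :=: <<s |: P>> by rewrite def_S -genP; exact: joing_idr.
have sQ : s \in Q := subsetP (stabiliser_sub _ _ _ _) _ sS.
have PQ : P \subset Q.
  by rewrite (subset_trans (subset_gen P)) // genP stabiliser_sub.
(* Each additional generator costs [#|Q|], which is thus absorbed by [#|O|]. *)
have cardO : (#|Q| <= #|O|)%N.
  rewrite -(card_imset (mem Q) (_ : injective (fun q : gT => translate q p0))); last exact: translate_inj.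
  by apply/subset_leq_card/subsetP => _ /imsetP[q qQ ->]; rewrite orbit_class_translate ?orbit_class_refl.
(* [phi x] is to carry the component of [w] to that of x. The choice is made at coset
   representatives and extended equivariantly; the default 1 is taken only outside [Y0]. *)
pose psi z := if [pick q in Q | connect r0 (q * w) z] is Some q then q else 1.
pose phi x := rcoset_ratio Q x * psi (repr (Q :* x)).
have phiQ : equivariant Q phi.
  split=> [x|q x qQ]; rewrite /phi.
    rewrite groupM ?rcoset_ratio_mem // /psi; by case: pickP => [q /andP[]|].
  by rewrite rcoset_ratioM // rcosetM (rcoset_id qQ) -mulgA.
pose Y0 := [set x | [exists q in Q, connect r0 (q * w) x]].
have phi_w x : x \in Y0 -> connect r0 (phi x * w) x.
  rewrite inE => /exists_inP[q qQ qx].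
  have ratQ := rcoset_ratio_mem Q x.
  have def_x : x = rcoset_ratio Q x * repr (Q :* x) by rewrite mulgKV.
  rewrite [X in connect _ _ X]def_x /phi -mulgA connect_r0_translate // /psi.
  case: pickP => [g /andP[] //|/(_ ((rcoset_ratio Q x)^-1 * q))].
  rewrite groupM ?groupV //= -(connect_r0_translate _ _ ratQ) mulgA mulKVg.
  by rewrite -def_x qx.
have phi_ratio x q : x \in Y0 -> q \in Q -> connect r0 (q * w) x -> q^-1 * phi x \in S.
  move=> xY qQ qx; rewrite (stabiliser_ratio (@mul1g gT) (fun g h z => esym (mulgA g h z)) r0_translate) //.
    by apply: connect_trans qx _; rewrite r0_conn_sym phi_w.
  by case: phiQ.
have r0_ratio x y : x \in Y0 -> y \in Y0 -> r0 x y -> (phi x)^-1 * phi y \in S.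
  move=> xY yY xy; apply: phi_ratio => //; first by case: phiQ.
  by apply: connect_trans (phi_w x xY) (connect1 xy).
have QY0 : invariant_under Q Y0.
  have le q x : q \in Q -> x \in Y0 -> q * x \in Y0.
    rewrite !inE => qQ /exists_inP[g gQ gx]; apply/exists_inP.
    by exists (q * g); rewrite ?groupM // -mulgA connect_r0_translate.
  move=> q x qQ; apply/idP/idP; last exact: le.
  by move/(le q^-1); rewrite groupV mulKg; exact.
have [/exists_inP[t tQ tw]|no_t] := boolP [exists t in Q, connect r0 (t * w) w'].
  have w'x q x : q \in Q -> connect r0 (q * w') x -> connect r0 (q * t * w) x.
    move=> qQ qx; apply: connect_trans qx.
    by rewrite -mulgA connect_r0_translate.
  have allY x : x \in Y0.
    rewrite inE; apply/exists_inP; have [q qQ qx] := near_orbit x.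
    have {qx} : connect r0 (q * w) x || connect r0 (q * w') x.
      by case: ends => -[-> ->]; rewrite // orbC.
    by case/orP=> qx; [exists q | exists (q * t); rewrite ?groupM ?w'x].
  exists [set: gT]; split=> [|x y|x y _]; rewrite ?inE //.
  split=> [q x _|]; first by rewrite !inE.
  exists phi, (t |: (s |: P)); split=> //.
  - by rewrite !subUset !sub1set tQ sQ.
  - have SP : S \subset <<t |: (s |: P)>> by rewrite def_S genS // subsetUr.
    have tP : t \in <<t |: (s |: P)>> by rewrite mem_gen ?setU11.
    have cross a b q : q \in Q -> connect r0 (q * w) a -> connect r0 (q * w') b ->
        (phi a)^-1 * phi b \in <<t |: (s |: P)>>.
      move=> qQ qa qb.
      (* [q] and [q * t] carry the component of [w] to those of a and b, so both outer factors lie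
         in [S]. *)
      have -> : (phi a)^-1 * phi b = (q^-1 * phi a)^-1 * t * ((q * t)^-1 * phi b).
        by move: (phi a) (phi b) => fa fb; rewrite !invMg invgK !mulgA !mulgK.
      have m1 : q^-1 * phi a \in S by apply: phi_ratio.
      have m2 : (q * t)^-1 * phi b \in S by apply: phi_ratio; rewrite ?groupM ?w'x.
      exact: (groupM (groupM (groupVr (subsetP SP _ m1)) tP) (subsetP SP _ m2)).
    move=> x y _ _ xy; have [r0xy|nr0xy] := boolP (r0 x y).
      by rewrite (subsetP SP) ?r0_ratio.
    have [q qQ /orP[/andP[qx qy]|/andP[qx qy]]] := edge_ends ends xy nr0xy.
      exact: cross qx qy.
    by rewrite -groupV invMg invgK; exact: cross qy qx.
  rewrite (_ : cut_pairs B _ = set0); last by apply/setP => p; rewrite !inE.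
  rewrite cards0 addn0 !cardsU1.
  move: (t \notin _) (s \notin _) cardP cardO; move: #|P| #|Q| #|B| #|O| => a b c d.
  by clear=> -[] [] *; nia.
(* In the amalgam case no edge of [O] has both ends in [Y0]: all edges inside [Y0] belong to [r0],
   so their labels lie in [S]. *)
have notw' q x : q \in Q -> x \in Y0 -> ~~ connect r0 (q * w') x.
  rewrite inE => qQ /exists_inP[g gQ gx]; apply: contraNN no_t => qx; apply/exists_inP.
  exists (q^-1 * g); first by rewrite groupM ?groupV.
  rewrite -(connect_r0_translate _ _ qQ) mulgA mulKVg.
  by apply: connect_trans gx _; rewrite r0_conn_sym.
have bdY x y : x \in Y0 -> y \notin Y0 -> adj x y -> ((x, y) \in O) || ((y, x) \in O).
  move=> xY yY xy; apply: contraNT yY => /norP[xyO yxO].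
  move: xY; rewrite !inE => /exists_inP[q qQ qx]; apply/exists_inP; exists q => //.
  by apply: connect_trans qx (connect1 _); rewrite /r0 /delete xy xyO.
exists Y0; split=> //; last first.
  move=> x y /orbit_class_ends[q qQ /andP[q1 q2]].
  case: ends => -[e _]; rewrite /Y0 !inE e; apply/orP; [left|right];
    by apply/exists_inP; exists q.
split=> //; exists phi, (s |: P); split=> //.
- by rewrite subUset sub1set sQ.
- move=> x y xY yY xy; rewrite -def_S; apply: r0_ratio => //.
  apply/contraT => nr0xy; have [q qQ] := edge_ends ends xy nr0xy.
  by rewrite !(negPf (notw' _ _ qQ _)) // andbF.
have := cut_pairs_orbit_class bdY; rewrite cardsU1.
move: (s \notin _) cardP cardO; move: #|P| #|Q| #|B| #|O| #|cut_pairs _ _| => a b c d e.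
by clear=> -[] *; nia.
Qed.

End OneClass.
End CutClasses.

(** * Covering the group by light sets *)

Section LightCover.
Variables (gT : finGroupType) (Q : {group gT}) (B : {set gT}).
Hypothesis BV : forall x, x \in B -> x^-1 \in B.
Hypothesis conn : forall x y, connect (adj B) x y.

Lemma light_bigcup (I : finType) (A : {set I}) (Y : I -> {set gT}) (m : I -> nat) :
  (forall i, i \in A -> light Q B (Y i) (m i)) ->
  light Q B (\bigcup_(i in A) Y i) (\sum_(i in A) m i).
Proof.
move=> lightY; elim/big_rec2: _ => [|i k Z iA lightZ]; first exact: light0.
exact: lightU (lightY i iA) lightZ.
Qed.

(** The complement of [T] has density at most 3 / 4, so some translate of it meets the part still
    uncovered in at most three quarters of that part. Translates of [T] are as light as [T]. *)
Lemma light_translates T m j : Q <| [set: gT] -> light Q B T m -> (#|gT| <= 4 * #|T|)%N ->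
  exists2 Y, light Q B Y (j * m) & (4 ^ j * #|~: Y| <= 3 ^ j * #|gT|)%N.
Proof.
move=> nQ lightT bigT; elim: j => [|j [Y lightY smallY]].
  exists set0; first exact: light0.
  by rewrite !mul1n setC0 cardsT.
have [g _ le_g] := @exists_translate_small_meet _ [group of [set: gT]] (~: Y) (~: T)
  (subsetT _) (subsetT _).
exists (g *: T :|: Y); first exact: lightU (light_lcoset _ nQ lightT) lightY.
have eq_compl : ~: (g *: T :|: Y) = g *: ~: T :&: ~: Y.
  by apply/setP => x; rewrite !inE !mem_lcoset !inE negb_or.
rewrite eq_compl; move: le_g; rewrite cardsT; have := cardsC T.
have gT_gt0 : (0 < #|gT|)%N by rewrite -cardsT cardG_gt0.
move: bigT smallY gT_gt0; move: #|_ :&: _| #|~: Y| #|~: T| #|T| #|gT|; clear.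
move=> u y t' t w bigT smallY w_gt0 eq_w le_u.
have le1 : (4 * u <= 3 * y)%N by rewrite -(leq_pmul2r w_gt0); nia.
rewrite !expnS -mulnA mulnCA (leq_trans (leq_mul (leqnn _) le1)) //.
by rewrite mulnCA -mulnA leq_mul2l smallY orbT.
Qed.

Variable D : {set gT}.
Hypothesis QD : invariant_under Q D.
Notation E := (cut_pairs B D).

Definition separating_classes p1 p2 : bool :=
  [&& p1 \in E, p2 \in E, ~~ connect (slide B D) p1 p2 &
    [forall x, forall y, connect (delete B (slide_class B D p1 :|: slide_class B D p2)) x y]].

Definition one_sided (O : {set gT * gT}) (Y : {set gT}) :=
  (forall x y, x \in Y -> y \notin Y -> adj B x y -> ((x, y) \in O) || ((y, x) \in O)) /\
  (forall x y, (x, y) \in O -> (x \in Y) || (y \in Y)).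

(** For a cut edge (v, v'), either the class stabiliser has index below 3 in one of the two side
    stabilisers, and [light_side] applies, or both indices are at least 3, and [separating_pair]
    applies. *)
Lemma separating_or_light :
  (exists p1 p2, separating_classes p1 p2) \/
  exists Y : gT * gT -> {set gT}, forall p, p \in E ->
    light Q B (Y p) ((2 * #|B| + 3) * #|orbit_class Q B D p|) /\
    one_sided (orbit_class Q B D p) (Y p).
Proof.
have [/existsP[p1 /existsP[p2 sep]]|nosep] :=
  boolP [exists p1, exists p2, separating_classes p1 p2].
  by left; exists p1, p2.
right; apply: (@fin_all_exists _ _ (fun p Y => p \in E -> light Q B Y _ /\ one_sided _ Y)).
move=> [v v']; have [pE|_] := boolP ((v, v') \in E); last by exists set0.
pose S w := #|side_stabiliser B QD v v' w|; pose C := #|class_stabiliser B QD v v'|.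
have [lt_v|le_v] := ltnP (S v) (3 * C).
  have [Y [lightY bdY endY]] := light_side BV conn pE (or_introl erefl) lt_v.
  by exists Y.
have [lt_v'|le_v'] := ltnP (S v') (3 * C).
  have [Y [lightY bdY endY]] := light_side BV conn pE (or_intror erefl) lt_v'.
  by exists Y.
case/existsP: nosep; have [p1 [p2 [p1E p2E np12 conn12]]] := separating_pair BV conn pE le_v le_v'.
exists p1; apply/existsP; exists p2; rewrite /separating_classes p1E p2E np12 /=.
by apply/forallP => x; apply/forallP => y.
Qed.

(* For [u] outside the union [T] of the light sides, let [S] be the [Q]-orbit of
   its same-side component. Across each class bordering [S] lies the light side
   of that class, so [S] and [T] cover everything, and [S] is on one side of the
   cut. *)
Lemma light_side_of_cut (Y : gT * gT -> {set gT}) :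
  (forall p, p \in E ->
    light Q B (Y p) ((2 * #|B| + 3) * #|orbit_class Q B D p|) /\
    one_sided (orbit_class Q B D p) (Y p)) ->
  exists2 T, light Q B T ((2 * #|B| + 3) * #|E|) & D \subset T \/ ~: D \subset T.
Proof.
move=> YP; pose O p := orbit_class Q B D p.
have OP p : p \in E -> O p \subset E by exact: orbit_class_sub.
(* A representative depending only on the set [O p], so that each orbit is counted once and the
   orbit sizes sum to [#|E|]. *)
pose rho p := odflt p [pick p' in O p].
have rhoO p : rho p \in O p.
  by rewrite /rho; case: pickP => //= _; exact: orbit_class_refl.
have O_rho p : O (rho p) = O p by exact: (orbit_class_eq BV QD (rhoO p)).
have rho_eq p p' : O p = O p' -> rho p = rho p'.
  move=> eqO; rewrite /rho eqO; case: pickP => // /(_ p').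
  by rewrite /= [_ \in _](orbit_class_refl Q B D p').
have rhoE p : p \in E -> rho p \in E by move=> pE; apply: subsetP (rhoO p); exact: OP.
pose reps := rho @: E.
have repsE r : r \in reps -> r \in E by case/imsetP=> p pE ->; exact: rhoE.
pose T := \bigcup_(r in reps) Y r.
exists T.
  have -> : ((2 * #|B| + 3) * #|E| = \sum_(r in reps) (2 * #|B| + 3) * #|O r|)%N.
    rewrite -big_distrr /=; congr (_ * _)%N.
    rewrite -[LHS]sum1_card (partition_big rho (mem reps)) /=; last first.
      by move=> p pE; apply/imsetP; exists p.
    apply: eq_bigr => _ /imsetP[p pE ->].
    rewrite sum1dep_card; apply: eq_card => p'; rewrite inE.
    apply/andP/idP => [[p'E /eqP eq_rho]|p'O].
      by rewrite -eq_rho O_rho; exact: orbit_class_refl.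
    rewrite O_rho in p'O; split; first by apply: subsetP p'O; exact: OP.
    by apply/eqP/rho_eq; exact: (orbit_class_eq BV QD p'O).
  by apply: light_bigcup => r rR; case: (YP r (repsE r rR)).
have TP x : reflect (exists2 r, r \in reps & x \in Y r) (x \in T) by exact: bigcupP.
have QY r q x : r \in reps -> q \in Q -> (q * x \in Y r) = (x \in Y r).
  by move=> rR; case: (YP r (repsE r rR)) => -[QYr _] _; exact: QYr.
have bdY r x y : r \in reps -> x \in Y r -> y \notin Y r -> adj B x y ->
    ((x, y) \in O r) || ((y, x) \in O r).
  by move=> rR; case: (YP r (repsE r rR)) => _ [bd _]; exact: bd.
have endY r x y : r \in reps -> (x, y) \in O r -> (x \in Y r) || (y \in Y r).
  by move=> rR; case: (YP r (repsE r rR)) => _ [_ ends]; exact: ends.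
have sameY r x y : r \in reps -> same_side B D x y -> x \in Y r -> y \in Y r.
  move=> rR /andP[xy /eqP xDy] xY; apply/contraT => yY.
  have := bdY r x y rR xY yY xy.
  by case/orP=> /(subsetP (OP r (repsE r rR))); rewrite cut_pairsE xDy; case: (y \in D).
have [/subsetP allT|/subsetPn[u _ uT]] := boolP ([set: gT] \subset T).
  by left; apply/subsetP => x _; exact: allT.
pose S := [set x | [exists q in Q, connect (same_side B D) (q * u) x]].
have SP x : reflect (exists2 q, q \in Q & connect (same_side B D) (q * u) x) (x \in S).
  by rewrite inE; exact: exists_inP.
have sameS x y : connect (same_side B D) x y -> x \in S -> y \in S.
  by move=> xy /SP[q qQ qx]; apply/SP; exists q => //; exact: connect_trans qx xy.
have QS q x : q \in Q -> x \in S -> q * x \in S.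
  move=> qQ /SP[g gQ gx]; apply/SP; exists (q * g); first by rewrite groupM.
  rewrite -mulgA (connect_act (@mul1g _) (fun g h z => esym (mulgA g h z))
    (@same_side_translate _ _ B _ QD) _ _ qQ) //.
have u1 : u \in S by apply/SP; exists 1; rewrite ?mul1g ?connect0.
have S_D x : x \in S -> (x \in D) = (u \in D).
  case/SP=> q qQ /connectP[s]; elim/last_ind: s x => [|s a IHs] x /=.
    by move=> _ ->; exact: QD.
  rewrite rcons_path last_rcons => /andP[qs /andP[_ /eqP sa]] ->.
  by rewrite -sa; exact: IHs.
(* Each [Y r] is closed under same-side steps and under [Q], so if it met [S] it would contain u. *)
have S_T x : x \in S -> x \notin T.
  move=> xS; apply: contra uT => /TP[r rR xY]; apply/TP; exists r => //.
  case/SP: xS => q qQ qx; rewrite -(QY r q) //.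
  have sym := sym_connect_sym (@same_side_sym _ _ BV D).
  move: qx; rewrite sym => /connectP[s]; elim: s x xY => [|a s IHs] x xY /=.
    by move=> _ ->.
  by case/andP=> xa; apply: IHs; exact: sameY xa xY.
have spread r p p' : p \in O r -> p' \in O r ->
    (p.1 \in S -> p'.1 \in S) /\ (p.2 \in S -> p'.2 \in S).
  move=> pO p'O; move: p'O; rewrite -[O r](orbit_class_eq BV QD pO).
  case/orbit_classP=> q qQ /connect_slide_same_side /andP[c1 c2].
  by split=> pS; [apply: sameS c1 _|apply: sameS c2 _]; exact: QS.
pose Z := [set x | (x \in S) || [exists r in reps, (x \in Y r) &&
    [exists p in O r, (p.1 \in S) || (p.2 \in S)]]].
have ZE x : (x \in Z) = (x \in S) || [exists r in reps, (x \in Y r) &&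
    [exists p in O r, (p.1 \in S) || (p.2 \in S)]] by rewrite in_set.
have inZ x : x \in Z.
  apply: (closed_setT BV conn (z := u)) => [|{}x y]; first by rewrite ZE u1.
  rewrite !ZE => /orP[xS|/exists_inP[r rR /andP[xY /exists_inP[p pO pS]]]] xy.
    have [same|diff] := boolP (same_side B D x y).
      by rewrite (sameS x y) ?connect1.
    have [a aE a_ends] : exists2 a, a \in E & a = (x, y) \/ a = (y, x).
      move: diff; rewrite /same_side xy /=; case xD: (x \in D); case yD: (y \in D) => // _.
        by exists (x, y); [rewrite cut_pairsE xD yD | left].
      by exists (y, x); [rewrite cut_pairsE xD yD (adj_sym BV) | right].
    have rR : rho a \in reps by apply/imsetP; exists a.
    have aO : a \in O (rho a) by rewrite O_rho; exact: orbit_class_refl.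
    have xY : x \notin Y (rho a).
      by apply: contra (S_T x xS) => xY; apply/TP; exists (rho a).
    have yY : y \in Y (rho a).
      have : ((x, y) \in O (rho a)) || ((y, x) \in O (rho a)).
        by case: a_ends => <-; rewrite aO ?orbT.
      by case/orP=> /(endY _ _ _ rR); rewrite (negPf xY) ?orbF.
    apply/orP; right; apply/exists_inP; exists (rho a) => //; rewrite yY.
    apply/exists_inP; exists a => //.
    by case: a_ends => ->; rewrite /= xS ?orbT.
  have [yY|yY] := boolP (y \in Y r).
    apply/orP; right; apply/exists_inP; exists r => //; rewrite yY.
    by apply/exists_inP; exists p.
  (* The edge leaving [Y r] lies in [O r], like p. By [spread] it has an end in [S] on the same side
     of the cut as p does; that end is not x, so it is y. *)
  have xS : x \notin S by apply: contraL xY => xS; apply: contra (S_T x xS) => xY; apply/TP; exists r.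
  apply/orP; left; have := bdY r x y rR xY yY xy.
  case/orP=> /(spread r p _ pO)[/= s1 s2]; case/orP: pS => [/s1|/s2] //.
    by rewrite (negPf xS).
  by rewrite (negPf xS).
have inST x : x \notin S -> x \in T.
  move=> xS; have := inZ x; rewrite ZE (negPf xS) => /exists_inP[r rR /andP[xY _]].
  by apply/TP; exists r.
have [uD|uD] := boolP (u \in D); [right|left]; apply/subsetP => x xD; apply: inST.
  by apply: contraL xD => /S_D; rewrite uD inE => ->.
by apply: contraL xD => /S_D ->.
Qed.

Lemma large_light_set : ~ (exists p1 p2, separating_classes p1 p2) ->
  (#|gT| <= 4 * #|D|)%N -> (2 * #|D| <= #|gT|)%N ->
  exists2 T, light Q B T ((2 * #|B| + 3) * #|E|) & (#|gT| <= 4 * #|T|)%N.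
Proof.
case: separating_or_light => [//|[Y /light_side_of_cut[T lightT side]]] _ D_big D_half.
exists T => //; case: side => /subset_leq_card le_DT.
  by rewrite (leq_trans D_big) // leq_mul2l le_DT.
move: (cardsC D) le_DT D_half; move: #|D| #|~: D| #|T| #|gT|; clear; lia.
Qed.

(** The y vertices missed by j translates of [T] are added by [light_trivial] at cost [#|B|] each,
    which makes the whole group light. *)
Lemma few_generators T m j : Q <| [set: gT] -> light Q B T m -> (#|gT| <= 4 * #|T|)%N ->
  exists P y, [/\ <<P>> = Q, (#|P| * #|Q| <= j * m + #|B| * y)%N &
    (4 ^ j * y <= 3 ^ j * #|gT|)%N].
Proof.
move=> nQ lightT T_big; have [Y lightY smallY] := light_translates j nQ lightT T_big.
have QY : invariant_under Q (~: Y).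
  by case: lightY => QY _ q x qQ; rewrite !inE QY.
have := lightU BV lightY (light_trivial B QY); rewrite setUCr => light_all.
have [P [genP cardP]] := light_setT_gen BV conn light_all.
by exists P, #|~: Y|.
Qed.

End LightCover.

(* After [few_steps p b] translates, each covering a quarter of what is left, less
   than [#|gT| / (2 * p * b)] remains uncovered. *)
Definition few_steps p b := (6 * (p * b)).+1.

Lemma few_stepsP p b : (2 * (p * b) * 3 ^ few_steps p b < 4 ^ few_steps p b)%N.
Proof.
have := leq_expn_Bernoulli 3 (6 * (p * b)); rewrite -/(few_steps p b).
rewrite /few_steps; set c := (6 * _)%N; apply: leq_trans.
have : (0 < 3 ^ c)%N by rewrite expn_gt0.
by rewrite expnS /c; move: (3 ^ _)%N => z; nia.
Qed.

(* Chosen so that [few_steps p b] light sets cost at most [#|gT| / (2 * p)]. *)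
Definition cut_slowness p b := (2 * p * few_steps p b * (2 * b + 3) * b).+1.

(** The size that [Folner_cut] requires, per coset of [H]: its exponent [W : H] |B| is at most b
    [W : H]. *)
Definition index_base p b :=
  let m := (cut_slowness p b).*2.+1 in ((4 * m ^ (m ^ 2).+1) ^ b)%N.

(** If nothing separates, [few_generators] bounds the cost of generating [Q] by two terms, from the
    cut edges and from the uncovered vertices. By the choice of constants, p times the first is at
    most half of [#|gT|] and p times the second is less than half, against the last hypothesis. *)
Theorem exists_separating_classes (p b : nat) (gT : finGroupType) (Q H : {group gT}) (B : {set gT}) :
  Q <| [set: gT] -> Q \subset H -> abelian (H / Q) ->
  (forall x, x \in B -> x^-1 \in B) -> (forall x y, connect (adj B) x y) ->
  B != set0 -> (#|B| <= b)%N ->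
  (index_base p b ^ #|[set: gT] : H| <= #|H / Q|)%N ->
  (forall P : {set gT}, <<P>> = Q -> (#|gT| <= p * #|P| * #|Q|)%N) ->
  exists D p1 p2, separating_classes B D p1 p2.
Proof.
move=> nQ QH abHQ BV conn B0 Bb big rank_big.
pose j := few_steps p b; pose k := cut_slowness p b.
have k_gt0 : (0 < k)%N by [].
have big' : ((4 * k.*2.+1 ^ (k.*2.+1 ^ 2).+1) ^ (#|[set: gT] : H| * #|B|) <= #|H / Q|)%N.
  apply: leq_trans big; rewrite /index_base -/k -expnM leq_pexp2l //.
    by rewrite muln_gt0 expn_gt0.
  by rewrite mulnC leq_mul2r Bb orbT.
have [D [QD D_big D_half bdD]] := Folner_cut nQ k_gt0 B0 QH abHQ big'.
exists D; have [/existsP[p1 /existsP[p2 sep]]|nosep] :=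
  boolP [exists p1, exists p2, separating_classes B D p1 p2]; first by exists p1, p2.
have [|T lightT T_big] := large_light_set BV conn QD _ D_big D_half.
  by case=> p1 [p2 sep]; case/existsP: nosep; exists p1; apply/existsP; exists p2.
have [P [y [genP cardP le_y]]] := few_generators BV conn j nQ lightT T_big.
have := rank_big P genP; have := few_stepsP p b; rewrite -/j.
have w_gt0 : (0 < #|gT|)%N by rewrite -cardsT cardG_gt0.
have f_gt0 : (0 < 4 ^ j)%N by rewrite expn_gt0.
(* [k] exceeds 2 p j (2 b + 3) b, and k times the number of cut edges is at most b [#|gT|]; the
   common factor b cancels. *)
have le1 : (2 * p * j * (2 * b + 3) * #|cut_pairs B D| <= #|gT|)%N.
  have [b0|b_gt0] := posnP b.
    by move: Bb; rewrite b0 leqn0 cards_eq0 (negPf B0).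
  rewrite -(leq_pmul2l b_gt0); apply: leq_trans (leq_trans bdD _); last by rewrite leq_mul2r Bb orbT.
  by rewrite mulnA leq_mul2r mulnC leqnSn orbT.
have le2 : (p * #|P| * #|Q| <= p * (j * ((2 * b + 3) * #|cut_pairs B D|) + b * y))%N.
  rewrite -mulnA leq_mul2l (leq_trans cardP) ?orbT // leq_add ?leq_mul2r ?Bb ?orbT //.
  by rewrite leq_mul2l leq_mul2r leq_add2r leq_mul2l Bb !orbT.
move: le1 le2 w_gt0 f_gt0 le_y; rewrite -/j.
move: #|cut_pairs B D| (p * #|P| * #|Q|)%N (4 ^ j)%N (3 ^ j)%N #|gT| => e x u t w.
clear=> le1 le2 w_gt0 u_gt0 le_y lt_tu le3.
have lt2 : (2 * (p * b) * y < w)%N.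
  rewrite -(ltn_pmul2l u_gt0) mulnCA.
  apply: leq_ltn_trans (leq_mul (leqnn _) le_y) _.
  by rewrite mulnA ltn_pmul2r.
have : (2 * w <= 2 * (p * (j * ((2 * b + 3) * e) + b * y)))%N.
  by rewrite leq_mul2l (leq_trans le3 le2).
by rewrite mulnDr mulnDr !mulnA in le1 lt2 *; lia.
Qed.

From HB Require Import structures.
From mathcomp Require Import all_order all_algebra finmap.
From mathcomp Require Import all_classical all_reals all_analysis.
Require Import Defs.

Import Order.TTheory GRing.Theory Num.Theory.
Import numFieldNormedType.Exports.

Local Open Scope group_scope.

(** * Words and cocycles *)

Lemma multiplicative1 (G H : groupType) (f : {multiplicative G -> H}) : f 1 = 1.
Proof. by apply: (mulgI (f 1)); rewrite -gmulfM !mulg1. Qed.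

Lemma multiplicativeV (G H : groupType) (f : {multiplicative G -> H}) x :
  f x^-1 = (f x)^-1.
Proof. by apply: (mulgI (f x)); rewrite -gmulfM !mulgV multiplicative1. Qed.

Section Words.
Variables (X : choiceType) (H : groupType).
Implicit Types (u w : seq (X * bool)) (l : X -> H).

Definition letter_val l (a : X * bool) : H := if a.2 then l a.1 else (l a.1)^-1.

Definition word_val l u : H := foldr (fun a h => letter_val l a * h) 1 u.

Lemma word_val_cat l u w : word_val l (u ++ w) = word_val l u * word_val l w.
Proof. by elim: u => [|a u IHu] /=; rewrite ?mul1g // IHu mulgA. Qed.

Lemma letter_val_flip l a : letter_val l (flip a) = (letter_val l a)^-1.
Proof. by case: a => x [] /=; rewrite /letter_val /= ?invgK. Qed.

Definition letter (a : X * bool) : free_group X := exist (@reduced X) [:: a] isT.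

Definition free_word u : free_group X := foldr (fun a x => letter a * x) 1 u.

Lemma val_free_word u : val (free_word u) = foldr (@push X) [::] u.
Proof. by elim: u => //= a u ->. Qed.

Lemma free_wordK (x : free_group X) : free_word (val x) = x.
Proof.
apply: val_inj; rewrite val_free_word; have := valP x; elim: (val x) => //= a u IHu ru.
rewrite IHu; last exact: path_sorted ru.
by case: u ru {IHu} => //= b u /andP[/negPf-> _].
Qed.

Lemma letterV x : letter (x, false) = (letter (x, true))^-1.
Proof. exact: val_inj. Qed.

Lemma morph_free_word (f : {multiplicative free_group X -> H}) u :
  f (free_word u) = word_val (fun x => f (letter (x, true))) u.
Proof.
elim: u => [|[x b] u IHu] /=; first exact: multiplicative1.
rewrite gmulfM IHu; congr (_ * _); case: b => //.
by rewrite letterV multiplicativeV.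
Qed.

End Words.

Section WordBall.
Variables (n : nat) (W : finGroupType) (l : 'I_n -> W).
Implicit Types (u : seq ('I_n * bool)) (w : W).

Fixpoint word_ball k : {set W} :=
  if k is k'.+1 then
    (word_ball k' :|: [set p.1 * letter_val l p.2 | p in finset.setX (word_ball k') [set: 'I_n * bool]])%SET
  else [set 1]%SET.

Lemma word_ballP k w :
  reflect (exists2 u, (size u <= k)%N & word_val l u = w) (w \in word_ball k).
Proof.
apply: (iffP idP) => [|[u]].
  elim: k w => [|k IHk] w; first by rewrite inE => /eqP->; exists [::].
  rewrite inE => /orP[/IHk[u le_u <-]|/imsetP[[g a]]]; first by exists u; rewrite // leqW.
  rewrite inE => /andP[/= /IHk[u le_u <-] _] ->; exists (rcons u a).
    by rewrite size_rcons.
  by rewrite -cats1 word_val_cat /= mulg1.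
elim: k w u => [|k IHk] w u; first by rewrite leqn0 size_eq0 => /eqP-> <-; rewrite inE.
case/lastP: u => [_ <-|u a]; first by rewrite inE (IHk 1 [::]).
rewrite size_rcons ltnS => le_u <-; apply/setUP; right.
apply/imsetP; exists (word_val l u, a); first by rewrite !inE /= (IHk _ u).
by rewrite -cats1 word_val_cat /= mulg1.
Qed.

(** The bound does not involve [W], so one constant serves all finite quotients. *)
Lemma card_word_ball k : (#|word_ball k| <= (n * 2).+1 ^ k)%N.
Proof.
elim: k => [|k IHk]; first by rewrite cards1.
apply: leq_trans (leq_card_setU _ _) _.
rewrite expnS mulSn leq_add // (leq_trans (leq_imset_card _ _)) //.
by rewrite cardsX cardsT card_prod card_ord card_bool mulnC leq_mul2l IHk orbT.
Qed.

Lemma word_val_inv u : word_val l (word_inv u) = (word_val l u)^-1.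
Proof.
elim: u => [|a u IHu]; first by rewrite /= invg1.
rewrite /word_inv /= rev_cons -cats1 word_val_cat -/(word_inv u) IHu /= mulg1.
by rewrite letter_val_flip invMg.
Qed.

Lemma word_ballV k w : w \in word_ball k -> w^-1 \in word_ball k.
Proof.
case/word_ballP=> u le_u <-; apply/word_ballP; exists (word_inv u).
  by rewrite /word_inv size_rev size_map.
exact: word_val_inv.
Qed.

End WordBall.

Section Cocycle.
Variables (n L : nat) (W : finGroupType) (l : 'I_n -> W) (F : groupType).
Hypothesis L_gt0 : (0 < L)%N.
Notation adj := (adj (word_ball l L)).
Variable c : W -> W -> F.
Hypothesis cocycle : forall x y z, adj x y -> adj y z -> adj x z ->
  c x y * c y z = c x z.
Implicit Types (u : seq ('I_n * bool)) (v x y : W).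

Fixpoint transport v u : F :=
  if u is a :: u' then
    c v (v * letter_val l a) * transport (v * letter_val l a) u'
  else 1.

Let adj_word v u : (size u <= L)%N -> adj v (v * word_val l u).
Proof. by move=> le_u; rewrite /adj mulKg; apply/word_ballP; exists u. Qed.

Let adj_letter v a : adj v (v * letter_val l a).
Proof. by have := adj_word v (_ : size [:: a] <= L)%N; rewrite /= mulg1; apply. Qed.

Let adj_refl v : adj v v.
Proof. by have := @adj_word v [::]; rewrite /= mulg1; apply. Qed.

Let c_refl v : c v v = 1.
Proof. by apply: (mulgI (c v v)); rewrite cocycle // mulg1. Qed.

Lemma transport_cat v u w :
  transport v (u ++ w) = transport v u * transport (v * word_val l u) w.
Proof.
elim: u v => [|a u IHu] v /=; first by rewrite mul1g mulg1.
by rewrite IHu !mulgA.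
Qed.

(** Going along an edge and back contributes c x y * c y x = c x x = 1, so transport survives free
    reduction. *)
Lemma transport_push v a u : transport v (push a u) = transport v (a :: u).
Proof.
case: u => [|b u] //=; case: eqP => [->|//] /=.
rewrite letter_val_flip mulgK mulgA cocycle ?c_refl ?mul1g //.
by have := adj_letter (v * letter_val l a) (flip a); rewrite letter_val_flip mulgK.
Qed.

Lemma transport_free_word v u : transport v (val (free_word u)) = transport v u.
Proof.
rewrite val_free_word; elim: u v => //= a u IHu v.
by rewrite transport_push /= IHu.
Qed.

Lemma transport_mul v (x y : free_group 'I_n) :
  transport v (val (x * y)) = transport v (val x) * transport (v * word_val l (val x)) (val y).
Proof.
rewrite -transport_cat -[RHS]transport_free_word; congr (transport _ (val _)).
rewrite -{1}(free_wordK x) -{1}(free_wordK y).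
elim: (val x) => [|a u IHu] /=; first by rewrite mul1g.
by rewrite -mulgA IHu.
Qed.

(** All prefixes of [u] stay within the ball around [v], so the path is the rim of a fan of
    triangles with apex [v]. This is why the ball must have the length of the relators as radius. *)
Lemma transport_short v u : (size u <= L)%N -> transport v u = c v (v * word_val l u).
Proof.
elim/last_ind: u => [|u a IHu]; first by rewrite /= mulg1 c_refl.
rewrite size_rcons => lt_u; rewrite -cats1 transport_cat IHu 1?ltnW //= !mulg1.
rewrite word_val_cat /= mulg1 mulgA; apply: cocycle; rewrite ?adj_word ?adj_letter 1?ltnW //.
by have := adj_word v (_ : size (rcons u a) <= L)%N; rewrite size_rcons -cats1 word_val_cat /= mulg1 mulgA; apply.
Qed.

End Cocycle.

Section CutCocycle.
Variables (W : finGroupType) (B D : {set W}) (F : groupType).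
Hypothesis BV : forall x, x \in B -> x^-1 \in B.
Variable weight : W * W -> F.
Hypothesis weight_slide : forall p p', slide B D p p' -> weight p = weight p'.

Definition cut_cocycle x y : F :=
  if x \in D then if y \in D then 1 else weight (x, y)
  else if y \in D then (weight (y, x))^-1 else 1.

(** A triangle crosses the cut in no edge or in two. Two crossing edges share an end and slide into
    each other, so their weights agree, and the orientations give the identity. *)
Lemma cut_cocycleP x y z : adj B x y -> adj B y z -> adj B x z ->
  cut_cocycle x y * cut_cocycle y z = cut_cocycle x z.
Proof.
have sym := adj_sym BV.
have eq_snd s t t' : s \in D -> t \notin D -> t' \notin D ->
    adj B s t -> adj B s t' -> adj B t t' -> weight (s, t) = weight (s, t').
  move=> sD tD t'D st st' tt'; apply: weight_slide.
  by rewrite /slide !cut_pairsE sD tD t'D st st' /= eqxx tt'.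
have eq_fst s s' t : s \in D -> s' \in D -> t \notin D ->
    adj B s t -> adj B s' t -> adj B s s' -> weight (s, t) = weight (s', t).
  move=> sD s'D tD st s't ss'; apply: weight_slide.
  by rewrite /slide !cut_pairsE sD tD s'D st s't /= eqxx ss' orbT.
move=> xy yz xz; have yx := xy; have zy := yz; have zx := xz.
rewrite sym in yx; rewrite sym in zy; rewrite sym in zx.
rewrite /cut_cocycle; case xD: (x \in D); case yD: (y \in D); case zD: (z \in D);
  rewrite ?mulg1 ?mul1g //.
- by apply: eq_fst; rewrite ?zD.
- by rewrite (eq_fst x z) ?mulgV // yD.
- by apply: eq_snd; rewrite ?yD ?zD.
- by congr _^-1; apply: eq_fst; rewrite ?xD.
- by rewrite (eq_snd y x z) ?mulVg // ?xD ?zD.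
- by congr _^-1; apply: eq_snd; rewrite ?xD ?yD.
Qed.

End CutCocycle.

Section SeparatingLoops.
Variables (n L : nat) (W : finGroupType) (l : 'I_n -> W) (F : groupType).
Hypothesis L_gt0 : (0 < L)%N.
Notation B := (word_ball l L).
Variables (D : {set W}) (p1 p2 : W * W).
Hypothesis sep : separating_classes B D p1 p2.
Variables a1 a2 : F.

Definition class_weight p : F :=
  if connect (slide B D) p1 p then a1 else if connect (slide B D) p2 p then a2 else 1.

Lemma class_weight_slide p p' : slide B D p p' -> class_weight p = class_weight p'.
Proof.
move=> pp'; have eq_c q : connect (slide B D) q p = connect (slide B D) q p'.
  apply: (same_connect_r (connect_slide_sym (@word_ballV _ _ l L) D)).
  exact: connect1.
by rewrite /class_weight !eq_c.
Qed.

Definition class_cocycle := cut_cocycle D class_weight.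

Lemma class_cocycleP x y z : adj B x y -> adj B y z -> adj B x z ->
  class_cocycle x y * class_cocycle y z = class_cocycle x z.
Proof.
apply: cut_cocycleP; [exact: word_ballV | exact: class_weight_slide].
Qed.

Let transport := (transport l class_cocycle).

Lemma edge_word x y : adj B x y ->
  exists2 u, x * word_val l u = y & transport x u = class_cocycle x y.
Proof.
case/word_ballP=> u le_u eq_u; exists u; first by rewrite eq_u mulKVg.
by rewrite /transport (transport_short L_gt0 class_cocycleP) // eq_u mulKVg.
Qed.

(** Follow a path that avoids both classes: each step is spelled by a word, and crossings of all
    other classes have weight 1. *)
Lemma free_path x y :
  exists2 u, x * word_val l u = y & transport x u = 1.
Proof.
have /and4P[_ _ _ /forallP/(_ x)/forallP/(_ y)] := sep.
case/connectP=> s; elim: s x => [|z s IHs] x /=.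
  by move=> _ ->; exists [::]; rewrite ?mulg1.
case/andP=> /and3P[xz xzL zxL] zs /(IHs z zs)[u eq_u tr_u].
have [w eq_w tr_w] := edge_word xz.
exists (w ++ u); first by rewrite word_val_cat mulgA eq_w.
rewrite /transport transport_cat -/transport tr_w eq_w tr_u mulg1.
rewrite /class_cocycle /cut_cocycle /class_weight.
move: xzL zxL; rewrite !inE => /norP[/negPf-> /negPf->] /norP[/negPf-> /negPf->].
by rewrite invg1; case: ifP; case: ifP.
Qed.

(** Reach x freely from 1, cross the edge once, and return freely from y. *)
Lemma edge_loop x y : (x, y) \in cut_pairs B D ->
  exists2 u, word_val l u = 1 & transport 1 u = class_weight (x, y).
Proof.
rewrite cut_pairsE => /and3P[xD yD xy].
have [u eq_u tr_u] := free_path 1 x; have [v eq_v tr_v] := edge_word xy.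
have [w eq_w tr_w] := free_path y 1.
exists (u ++ v ++ w).
  by rewrite !word_val_cat -[_ u]mul1g eq_u mulgA eq_v.
rewrite /transport !transport_cat -/transport tr_u eq_u tr_v eq_v tr_w mulg1 mul1g.
by rewrite /class_cocycle /cut_cocycle xD (negPf yD).
Qed.

Lemma separating_loops :
  (exists2 u, word_val l u = 1 & transport 1 u = a1) /\
  (exists2 u, word_val l u = 1 & transport 1 u = a2).
Proof.
have /and4P[p1E p2E p12 _] := sep; split.
  have [|u eq_u tr_u] := @edge_loop p1.1 p1.2; first by rewrite -surjective_pairing.
  by exists u; rewrite // tr_u -surjective_pairing /class_weight connect0.
have [|u eq_u tr_u] := @edge_loop p2.1 p2.2; first by rewrite -surjective_pairing.
by exists u; rewrite // tr_u -surjective_pairing /class_weight (negPf p12) connect0.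
Qed.

End SeparatingLoops.

Local Open Scope classical_set_scope.

(** * The morphism on K defined by a cocycle *)

Section CocycleMorphism.
Variables (n : nat) (G : groupType) (f : {multiplicative free_group 'I_n -> G}).
Variable R : {fset free_group 'I_n}.
Hypothesis f_onto : range f = [set: G].
Hypothesis ker_f : f @^-1` [set 1] = normal_closure [set` R].
Variables (W : finGroupType) (pi : {multiplicative G -> W}) (F : groupType).
Let l i : W := pi (f (letter (i, true))).
Variable L : nat.
Hypothesis L_gt0 : (0 < L)%N.
Hypothesis RL : forall r, r \in R -> (size (val r) <= L)%N.
Variable c : W -> W -> F.
Hypothesis cocycle : forall x y z, adj (word_ball l L) x y -> adj (word_ball l L) y z ->
  adj (word_ball l L) x z -> c x y * c y z = c x z.

Let t v (x : free_group 'I_n) := transport l c v (val x).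

Lemma word_val_pi u : word_val l u = pi (f (free_word u)).
Proof. exact: (esym (morph_free_word (pi \o f : {multiplicative _ -> _}) u)). Qed.

Let tM v x y : t v (x * y) = t v x * t (v * pi (f x)) y.
Proof. by rewrite /t (transport_mul L_gt0 cocycle) word_val_pi free_wordK. Qed.

Let t1 v : t v 1 = 1. Proof. by []. Qed.

Let tV v x : t v x^-1 = (t (v * (pi (f x))^-1) x)^-1.
Proof.
apply: (mulIg (t (v * (pi (f x))^-1) x)); rewrite mulVg.
by rewrite -(t1 v) -(mulVg x) tM !multiplicativeV.
Qed.

(** Triviality is asked at every base point [v], because conjugation moves the base point; this
    makes the set normal. *)
Let trivial_transport : set (free_group 'I_n) :=
  [set x | pi (f x) = 1 /\ forall v, t v x = 1].

Let trivial_transport_normal : is_normal trivial_transport.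
Proof.
split=> [|x g [pix tx]]; last first.
  split; first by rewrite /conjg !gmulfM pix mul1g !multiplicativeV mulVg.
  by move=> v; rewrite /conjg tM tM tx mul1g pix mulg1 -tM mulVg t1.
split=> [|x y]; rewrite ?inE; first by split=> //; rewrite !multiplicative1.
move=> [pix tx] [piy ty]; split=> [|v]; first by rewrite !gmulfM pix mul1g !multiplicativeV piy invg1.
by rewrite tM tx mul1g tV ty invg1.
Qed.

Let ker_trivial x : f x = 1 -> trivial_transport x.
Proof.
move=> fx; have : (f @^-1` [set 1]) x by [].
rewrite ker_f; apply; split=> // r rR.
have fr : f r = 1.
  have : normal_closure [set` R] r by move=> N [_ RN]; exact: RN.
  by rewrite -ker_f.
have pir : pi (f r) = 1 by rewrite fr multiplicative1.
split=> // v; have rL := RL rR.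
rewrite /t (transport_short L_gt0 cocycle) // word_val_pi free_wordK pir mulg1.
have vv : adj (word_ball l L) v v.
  by rewrite /adj mulVg; apply/word_ballP; exists [::].
by apply: (mulgI (c v v)); rewrite cocycle // mulg1.
Qed.

Let t_ext x y : f x = f y -> t 1 x = t 1 y.
Proof.
move=> fxy; have [|_ txy] := @ker_trivial (x^-1 * y).
  by rewrite gmulfM multiplicativeV fxy mulVg.
by rewrite -[y](mulKVg x) tM txy mulg1.
Qed.

Variable K : normal_subgroup G.
Hypothesis ker_pi : forall x, pi x = 1 <-> nsub_set K x.

(** By [t_ext], transport from 1 depends only on the element of [G]. An element of [K] brings the
    base point back to 1, so transport is multiplicative there. *)
Lemma cocycle_morphism : exists h : {multiplicative subgroup_type K -> F},
  forall u, word_val l u = 1 ->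
  exists k : subgroup_type K, h k = transport l c 1 u.
Proof.
have preim g : exists x, f x = g.
  have : range f g by rewrite f_onto.
  by case=> x _ <-; exists x.
have [pre preK] := choice preim.
pose h (k : subgroup_type K) := t 1 (pre (val k)).
have hM : {morph h : x y / x * y}.
  move=> x y; rewrite /h.
  rewrite (t_ext (y := pre (val x) * pre (val y))) ?gmulfM ?preK //.
  rewrite tM preK; have /ker_pi-> : nsub_set K (val x); last by rewrite mulg1.
  by have := valP x; rewrite inE.
pose hm := isMultiplicative.Build _ _ h hM.
pose hh : {multiplicative subgroup_type K -> F} := HB.pack h hm.
exists hh => u; rewrite word_val_pi => /ker_pi Ku.
have Ku' : f (free_word u) \in nsub_set K by rewrite inE.
pose k : subgroup_type K := exist (fun x => x \in nsub_set K) _ Ku'.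
exists k; rewrite /= /h /= (t_ext (y := free_word u)) ?preK //.
by rewrite /t (transport_free_word L_gt0 cocycle).
Qed.

End CocycleMorphism.

Lemma free_bool_not_abelian : ~ is_abelian [set: free_group bool].
Proof.
move=> /(_ (letter (true, true)) (letter (false, true))).
by rewrite !inE => /(_ I I)/(congr1 val).
Qed.

Lemma range_generators (X : choiceType) (H : groupType) (h : {multiplicative H -> free_group X}) :
  (forall x, exists k, h k = letter (x, true)) -> range h = [set: free_group X].
Proof.
move=> gens; apply/seteqP; split=> // y _; rewrite -(free_wordK y).
elim: (val y) => [|[x b] u [k _ hk]] /=; first by exists 1; rewrite ?multiplicative1.
have [g hg] := gens x; exists ((if b then g else g^-1) * k) => //.
by rewrite gmulfM hk; case: b; rewrite ?multiplicativeV hg // letterV.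
Qed.

Lemma separating_surjection (n : nat) (G : groupType) (f : {multiplicative free_group 'I_n -> G})
  (R : {fset free_group 'I_n}) (W : finGroupType) (pi : {multiplicative G -> W})
  (K : normal_subgroup G) (L : nat)
  (l := fun i => pi (f (letter (i, true)))) (D : {set W}) (p1 p2 : W * W) :
  range f = [set: G] -> f @^-1` [set 1] = normal_closure [set` R] ->
  (forall x, pi x = 1 <-> nsub_set K x) ->
  (0 < L)%N -> (forall r, r \in R -> (size (val r) <= L)%N) ->
  separating_classes (word_ball l L) D p1 p2 ->
  surjects_onto_nonabelian_free (subgroup_type K).
Proof.
move=> f_onto ker_f ker_pi L_gt0 RL sep.
pose a (b : bool) : free_group bool := letter (b, true).
have [[u1 eq_u1 tr_u1] [u2 eq_u2 tr_u2]] := separating_loops L_gt0 sep (a true) (a false).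
have [h hP] := cocycle_morphism f_onto ker_f L_gt0 RL
  (@class_cocycleP n L W l _ D p1 p2 (a true) (a false)) ker_pi.
exists bool, h; split; last exact: free_bool_not_abelian.
apply: range_generators => -[].
  by have [k hk] := hP u1 eq_u1; exists k; rewrite hk.
by have [k hk] := hP u2 eq_u2; exists k; rewrite hk.
Qed.

(** * Finite quotients *)

Local Open Scope group_scope.

(** The carrier remains [T], with an enumeration added, and the morphism is the identity. *)
Lemma finGroup_of_finite (T : groupType) : finite_set [set: T] ->
  exists (W : finGroupType) (f : {multiplicative T -> W}), bijective f.
Proof.
move=> finT; pose s := enum_fset (fset_set [set: T]).
have ax : Finite.axiom s.
  move=> x; rewrite count_uniq_mem ?fset_uniq //.
  by rewrite in_fset_set // mem_set.
have sT x : x \in s by rewrite in_fset_set // mem_set.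
have indexK : pcancel (fun x => index x s) (fun n => nth None (map Some s) n).
  by move=> x; rewrite (nth_map x) ?index_mem // nth_index.
pose cT := Choice_isCountable.Build T indexK.
pose C : countType := HB.pack T cT.
pose fT := fintype.isFinite.Build T ax.
pose F : finGroupType := HB.pack T cT fT.
by exists F, (idfun : {multiplicative F -> F}); exists id.
Qed.

Lemma coset_proj_surj (G : groupType) (K : normal_subgroup G) (a : quotient_group K) :
  exists x, coset_proj K x = a.
Proof. by exists (generic_quotient.repr a); exact: generic_quotient.reprK. Qed.

Lemma mem1_normal (G : groupType) (K : normal_subgroup G) : nsub_set K 1.
Proof. by have := (nsub_normal K).1.1; rewrite inE. Qed.

Lemma finite_quotient (G : groupType) (K : normal_subgroup G) :
  has_finite_index K -> finite_set [set: quotient_group K].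
Proof.
move=> finK; pose F (C : set G) := coset_proj K (xget 1 C).
apply: (sub_finite_set _ (finite_image F finK)) => a _.
have [x <-] := coset_proj_surj a.
exists [set x * b | b in nsub_set K]; first by exists x.
rewrite /F; case: xgetP => [y _ [b Kb <-]|/(_ x)]; last first.
  by case; exists 1; rewrite ?mulg1 //; exact: mem1_normal.
by apply/esym/coset_projP; rewrite mulKg inE.
Qed.

Lemma finite_index_finGroup (G : groupType) (K : normal_subgroup G) :
  has_finite_index K ->
  exists (W : finGroupType) (f : {multiplicative G -> W}),
    (forall w, exists x, f x = w) /\ (forall x, f x = 1 <-> nsub_set K x).
Proof.
move=> /finite_quotient /finGroup_of_finite[W [g bij_g]].
exists W, (g \o @coset_proj G K); split=> [w|x].
  have [h _ gh] := bij_g; have [x def_x] := coset_proj_surj (h w).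
  by exists x; rewrite /= def_x gh.
have g1 := multiplicative1 g.
rewrite /= -g1; split=> [/(bij_inj bij_g)|Kx]; last first.
  by congr (g _); apply/esym/coset_projP; rewrite invg1 mul1g inE.
rewrite -(multiplicative1 (@coset_proj G K)).
by move=> /esym/coset_projP; rewrite invg1 mul1g inE.
Qed.

Section FiniteImage.
Variables (G : groupType) (W : finGroupType) (pi : {multiplicative G -> W}).
Hypothesis pi_onto : forall w, exists x, pi x = w.
Variable K : normal_subgroup G.
Hypothesis ker_pi : forall x, pi x = 1 <-> nsub_set K x.

Definition represents (P : {group W}) (A : set G) := forall x, pi x \in P <-> A x.

Lemma normal_memM (A : normal_subgroup G) x y : nsub_set A x -> nsub_set A y -> nsub_set A (x * y).
Proof.
move=> Ax Ay; apply: set_mem; apply: (group_closedM (nsub_normal A).1); exact: mem_set.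
Qed.

Lemma normal_memV (A : normal_subgroup G) x : nsub_set A x -> nsub_set A x^-1.
Proof.
move=> Ax; apply: set_mem; apply: (group_closedV (nsub_normal A).1); exact: mem_set.
Qed.

Lemma exists_represents (A : normal_subgroup G) : nsub_set K `<=` nsub_set A ->
  exists2 P : {group W}, represents P (nsub_set A) & fingroup.normal P [set: W]%SET.
Proof.
move=> KA; pose S : {set W} := finset.finset (fun w => `[< exists2 x, nsub_set A x & pi x = w >]).
have memS x : pi x \in S <-> nsub_set A x.
  rewrite inE; split=> [/asboolP[y Ay eq_pi]|Ax]; last by apply/asboolP; exists x.
  rewrite -(mulKVg y x); apply: normal_memM => //; apply/KA/ker_pi.
  by rewrite gmulfM multiplicativeV eq_pi mulVg.
have gS : group_set S.
  apply/group_setP; split; first by rewrite -(multiplicative1 pi); apply/memS/mem1_normal.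
  move=> w w'; rewrite !inE => -[x Ax <-] [y Ay <-].
  by exists (x * y); [exact: normal_memM | rewrite gmulfM].
exists (Group gS) => //; apply/fingroup.normalP; split; first exact: finset.subsetT.
move=> w _; have [g <-] := pi_onto w; apply/setP => v.
have [x <-] := pi_onto v; rewrite mem_conjg.
have -> : pi x ^ (pi g)^-1 = pi (x ^ g^-1) by rewrite /conjg !gmulfM !multiplicativeV.
apply/idP/idP => /memS Ax; apply/memS; last exact: (nsub_normal A).2.
by rewrite -(conjgKV g x); exact: (nsub_normal A).2.
Qed.

Lemma subgroup_index_represents (A : set G) (B : normal_subgroup G) (PA PB : {group W}) :
  has_finite_index (nsub_set B) -> represents PA A -> represents PB (nsub_set B) ->
  subgroup_index A (nsub_set B) = #|PA : PB|.
Proof.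
move=> finB repA repB.
pose Phi (C : set G) : {set W} := finset.finset (fun w => `[< exists2 x, C x & pi x = w >]).
have PhiE x : Phi [set x * b | b in nsub_set B] = (pi x *: PB)%g.
  apply/setP => w; rewrite inE mem_lcoset; have [y <-] := pi_onto w.
  rewrite -multiplicativeV -gmulfM; apply/asboolP/idP => [[_ [b Bb <-] eq_y]|/repB Bxy].
    by rewrite gmulfM -eq_y gmulfM multiplicativeV mulKg; apply/repB.
  by exists y => //; exists (x^-1 * y); rewrite ?mulKVg.
have finAB : finite_set (lcosets A (nsub_set B)).
  by apply: sub_finite_set finB => _ [x _ <-]; exists x.
have memL C : (C \in fset_set (lcosets A (nsub_set B))) = (C \in lcosets A (nsub_set B)).
  exact: in_fset_set.
rewrite /subgroup_index -card_lcosets.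
have inj : {in fset_set (lcosets A (nsub_set B)) &, injective Phi}.
  move=> C C'; rewrite !memL !inE => -[x _ <-] [y _ <-]; rewrite !PhiE => eqP.
  have Bxy : nsub_set B (x^-1 * y).
    by apply/repB; rewrite gmulfM multiplicativeV -mem_lcoset eqP lcoset_refl.
  apply/seteqP; split=> _ [b Bb <-].
    exists ((x^-1 * y)^-1 * b); first by apply: normal_memM => //; exact: normal_memV.
    by rewrite invMg invgK !mulgA mulgV mul1g.
  by exists (x^-1 * y * b); [exact: normal_memM | rewrite !mulgA mulgV mul1g].
have <- : #|` [fset Phi C | C in fset_set (lcosets A (nsub_set B))]%fset| =
          #|` fset_set (lcosets A (nsub_set B))| by rewrite card_in_imfset.
rewrite cardE; apply: perm_size.
apply: uniq_perm; rewrite ?fset_uniq ?enum_uniq // => S.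
rewrite mem_enum; apply/imfsetP/lcosetsP => [[C /= CL ->]|[w wA ->]].
  move: CL; rewrite memL inE => -[x Ax <-]; exists (pi x); first exact/repA.
  exact: PhiE.
have [x def_w] := pi_onto w; exists [set x * b | b in nsub_set B]; last by rewrite PhiE def_w.
by rewrite /= memL inE; exists x => //; apply/repA; rewrite def_w.
Qed.

Lemma abelian_represents (A : set G) (B : normal_subgroup G) (PA PB : {group W}) :
  represents PA A -> represents PB (nsub_set B) -> fingroup.normal PB [set: W]%SET ->
  is_abelian (quotient_set A B) -> abelian (PA / PB).
Proof.
move=> repA repB nPB abAB.
have nB (S : {set W}) : S \subset 'N(PB).
  by apply: fintype.subset_trans (normal_norm nPB); exact: finset.subsetT.
rewrite /abelian quotient_cents2 // gen_subG; apply/fintype.subsetP => _ /imset2P[w w' wA w'A ->].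
have [x def_w] := pi_onto w; have [y def_w'] := pi_onto w'.
have Ax : A x by apply/repA; rewrite def_w.
have Ay : A y by apply/repA; rewrite def_w'.
have := abAB (coset_proj B x) (coset_proj B y); rewrite !inE.
move=> /(_ (ex_intro2 _ _ x Ax erefl) (ex_intro2 _ _ y Ay erefl)).
rewrite -!coset_is_multiplicative => /esym/coset_projP; rewrite inE => Bxy.
have -> : [~ w, w'] = pi ((y * x)^-1 * (x * y)).
  by rewrite -def_w -def_w' /commg /conjg invMg !gmulfM !multiplicativeV !mulgA.
exact/repB.
Qed.

Lemma group_rank_leq (H : groupType) (A : set H) (X : {fset H}) :
  generated_subgroup [set` X] = A -> (group_rank A <= #|` X|)%N.
Proof.
move=> genX; have gA : generated_by_card A #|` X| by exists X.
have ex : exists n, `[< generated_by_card A n >] by exists #|` X|; apply/asboolP.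
rewrite /group_rank; case: xgetP => [n _ [_ minn]|]; first exact: minn.
case: (ex_minnP ex) => m /asboolP gm min_m /(_ m) [].
by split=> // k gk; apply: min_m; apply/asboolP.
Qed.

(** Generators of [Q] lift to [J] through [pi], whose kernel is [K], and their cosets generate J /
    K. *)
Lemma rank_represents (J : normal_subgroup G) (Q : {group W}) (P : {set W}) :
  represents Q (nsub_set J) -> (<<P>> = Q)%g ->
  (group_rank (quotient_set (nsub_set J) K) <= #|P|)%N.
Proof.
move=> repJ genP; have [lift liftK] := choice pi_onto.
pose X : {fset quotient_group K} := [fset coset_proj K (lift w) | w in P]%fset.
have cardX : (#|` X| <= #|P|)%N by rewrite (leq_trans (leq_imfset_card _ _ _)) // cardE.
apply: leq_trans cardX; apply: group_rank_leq; apply/seteqP; split.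
  apply: smallest_sub => [|_ /= /imfsetP[w /= wP ->]].
    split=> [|u v]; rewrite !inE; last move=> [x Jx <-] [y Jy <-].
      by  exists 1; [exact: mem1_normal | exact: multiplicative1].
    exists (x * y^-1); first by apply: normal_memM => //; exact: normal_memV.
    by rewrite gmulfM (multiplicativeV (@coset_proj G K)).
  by exists (lift w) => //; apply/repJ; rewrite liftK -genP mem_gen.
move=> _ [x Jx <-] M [sM XM].
have MM u v : M u -> M v -> M (u * v).
  by move=> Mu Mv; apply: set_mem; apply: (group_closedM sM); exact: mem_set.
have M1 : M 1 by have := sM.1; rewrite inE.
(* The subgroup [M] of G / K is read as a subgroup of [W], where the generation hypothesis
   applies. *)
pose S : {set W} := finset.finset (fun w => `[< exists2 x, M (coset_proj K x) & pi x = w >]).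
have gS : group_set S.
  apply/group_setP; split.
    rewrite inE; apply/asboolP; exists 1; last exact: multiplicative1.
    by rewrite (multiplicative1 (@coset_proj G K)).
  move=> w w'; rewrite !inE => -[a Ma <-] [b Mb <-].
  by exists (a * b); rewrite gmulfM //; exact: MM.
have QS : Q \subset Group gS.
  rewrite -genP gen_subG; apply/fintype.subsetP => w wP; rewrite inE; apply/asboolP.
  by exists (lift w); [apply/XM/imfsetP; exists w | exact: liftK].
have := fintype.subsetP QS (pi x) ((repJ x).2 Jx); rewrite inE => /asboolP[y My eq_pi].
suff -> : coset_proj K x = coset_proj K y by [].
by apply/esym/coset_projP; rewrite inE; apply/ker_pi; rewrite gmulfM multiplicativeV eq_pi mulVg.
Qed.

End FiniteImage.

Lemma word_ball_connected (n L : nat) (W : finGroupType) (l : 'I_n -> W) :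
  (0 < L)%N -> (forall w, exists u, word_val l u = w) ->
  forall x y, connect (adj (word_ball l L)) x y.
Proof.
move=> L_gt0 l_gen x y; have [u def_u] := l_gen (x^-1 * y).
rewrite -(mulKVg x y) -def_u; elim: u x {def_u y} => [|a u IHu] x /=; first by rewrite mulg1.
rewrite mulgA; apply: connect_trans (IHu _); apply: connect1.
by rewrite /adj mulKg; apply/word_ballP; exists [:: a]; rewrite /= ?mulg1.
Qed.

(** [M] can be chosen before the triple because the triple affects the constants only through the
    size of the ball, which b bounds. *)
Lemma surjects_at_finite_stage (G : groupType) (p : nat) : finitely_presented G ->
  exists2 M : nat, (0 < M)%N & forall H J K : normal_subgroup G,
    has_finite_index (nsub_set H) -> has_finite_index (nsub_set J) ->
    has_finite_index (nsub_set K) ->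
    nsub_set J `<=` nsub_set H -> nsub_set K `<=` nsub_set J ->
    is_abelian (quotient_set (nsub_set H) J) ->
    (M ^ subgroup_index [set: G] (nsub_set H) <= subgroup_index (nsub_set H) (nsub_set J))%N ->
    (subgroup_index [set: G] (nsub_set J) <= p * group_rank (quotient_set (nsub_set J) K))%N ->
    surjects_onto_nonabelian_free (subgroup_type K).
Proof.
case=> n [f [R [f_onto ker_f]]].
(* The successor keeps the radius positive even without relators, so that the ball contains the
   generators. *)
pose L := (\max_(r <- R) size (val r)).+1.
have RL r : r \in R -> (size (val r) <= L)%N.
  move=> rR; apply: leqW.
  exact: (@leq_bigmax_seq _ (enum_fset R) xpredT (fun r => size (val r)) r rR isT).
pose b := ((n * 2).+1 ^ L)%N.
exists (index_base p b) => [|H J K finH finJ finK JH KJ abHJ big small].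
  by rewrite /index_base !(expn_gt0, muln_gt0).
have [W [pi [pi_onto ker_pi]]] := finite_index_finGroup finK.
have [PH repH nPH] := exists_represents pi_onto ker_pi (subset_trans KJ JH).
have [PJ repJ nPJ] := exists_represents pi_onto ker_pi KJ.
have repT : represents pi [group of [set: W]%SET] [set: G] by move=> x; rewrite finset.in_setT.
rewrite (subgroup_index_represents pi_onto finH repT repH) in big.
rewrite (subgroup_index_represents pi_onto finJ repH repJ) in big.
rewrite (subgroup_index_represents pi_onto finJ repT repJ) in small.
have PJH : PJ \subset PH.
  apply/fintype.subsetP => w; have [x <-] := pi_onto w.
  by move=> /repJ/JH Hx; apply/repH.
pose l i := pi (f (letter (i, true))).
have l_gen w : exists u, word_val l u = w.
  have [g <-] := pi_onto w; have : range f g by rewrite f_onto.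
  by case=> x _ <-; exists (val x); rewrite word_val_pi free_wordK.
have L_gt0 : (0 < L)%N by [].
have [|||||||D [p1 [p2 sep]]] := @exists_separating_classes p b W PJ PH (word_ball l L) nPJ PJH.
- exact: abelian_represents abHJ.
- by move=> x; exact: word_ballV.
- exact: word_ball_connected.
- by apply/set0Pn; exists 1; apply/word_ballP; exists [::].
- exact: card_word_ball.
- by rewrite card_quotient // (fintype.subset_trans _ (normal_norm nPJ)) // finset.subsetT.
- move=> P genP; rewrite -cardsT -(Lagrange (finset.subsetT PJ)) mulnC leq_mul2r.
  rewrite (leq_trans small) ?orbT // leq_mul2l.
  by rewrite (rank_represents pi_onto ker_pi repJ genP) orbT.
exact: separating_surjection f_onto ker_f ker_pi L_gt0 RL sep.
Qed.

(** * Limits and logarithms *)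

Local Open Scope ring_scope.

(** Otherwise [u] is eventually at most 1 / (p + 1) for every p, and its upper limit cannot be
    positive. *)
Lemma frequently_bounded_below (R : realType) (u : nat -> R) :
  (0 < limn_esup (fun i => (u i)%:E))%E ->
  exists p : nat, forall N : nat, exists2 i, (N <= i)%N & p.+1%:R^-1 < u i.
Proof.
move=> pos; apply: contrapT => nfreq.
have le_inv p : (limn_esup (fun i => (u i)%:E) <= (p.+1%:R^-1 : R)%:E)%E.
  have [N bdN] : exists N : nat, forall i, (N <= i)%N -> u i <= p.+1%:R^-1.
    apply: contrapT => nbd; apply: nfreq; exists p => N; apply: contrapT => nex.
    apply: nbd; exists N => i Ni; rewrite leNgt; apply/negP => lt_u.
    by apply: nex; exists i.
  rewrite /limn_esup limf_esupE.
  apply: le_trans (_ : ereal_sup [set (u i)%:E | i in [set i | (N <= i)%N]] <= _)%E.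
    apply: ereal_inf_lbound; exists [set i | (N <= i)%N] => //.
    by exists N.
  by apply: ge_ereal_sup => _ [i Ni <-]; rewrite lee_fin bdN.
move: pos le_inv; case: (limn_esup _) => [r| |] //; last by move=> _ /(_ 0%N).
rewrite lte_fin => r_gt0 le_inv; have [p] := ltr_add_invr r_gt0.
by rewrite add0r ltNge => /negP; apply; have := le_inv p; rewrite lee_fin.
Qed.

(** The summand 1 keeps the left-hand side positive even for M = 1. This rules out h = 0 and j = 0,
    where the quotient takes the default value 0 or the logarithm is not positive. *)
Lemma index_growth (R : realType) (M h j : nat) : (0 < M)%N ->
  (ln (M%:R : R) + 1 <= ln (j%:R : R) / h%:R)%R -> (M ^ h <= j)%N.
Proof.
move=> M_gt0 le_ratio; have lnM : 0 <= ln (M%:R : R) by rewrite ln_ge0 // ler1n.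
have pos : 0 < ln (M%:R : R) + 1 by rewrite ltr_wpDl.
have [h0|h_gt0] := posnP h.
  by move: le_ratio; rewrite h0 invr0 mulr0 leNgt pos.
have {}h_gt0 : 0 < h%:R :> R by rewrite ltr0n.
rewrite ler_pdivlMr // in le_ratio.
have j_gt0 : 0 < j%:R :> R.
  rewrite ltr0n lt0n; apply/eqP => j0; move: le_ratio.
  by rewrite j0 [leRHS]ln0 // leNgt mulr_gt0.
have Mh_pos : (M%:R : R) ^+ h \is Num.pos by rewrite posrE exprn_gt0 // ltr0n.
have j_pos : (j%:R : R) \is Num.pos by rewrite posrE.
rewrite -(ler_nat R) natrX -(ler_ln Mh_pos j_pos) lnXn ?ltr0n //.
by rewrite -[leLHS]mulr_natr (le_trans _ le_ratio) // ler_pM2r // lerDl.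
Qed.

Lemma infinite_of_frequent (S : set nat) :
  (forall N : nat, exists2 i, (N <= i)%N & S i) -> infinite_set S.
Proof.
move=> freq finS; have [i] := freq (\max_(j <- fset_set S) j).+1.
move=> lt_i Si; move: lt_i; rewrite ltnNge => /negP; apply.
have iS : i \in fset_set S by rewrite in_fset_set // mem_set.
exact: (@leq_bigmax_seq _ (enum_fset (fset_set S)) xpredT id i iS isT).
Qed.

Theorem theorem1p2 (R : realType) (G : groupType)
  (H J K : nat -> normal_subgroup G)
  (G_fp : finitely_presented G)
  (H_fin : forall i, has_finite_index (H i))
  (J_fin : forall i, has_finite_index (J i))
  (K_fin : forall i, has_finite_index (K i))
  (JH : forall i, J i `<=` H i)
  (KJ : forall i, K i `<=` J i)
  (HJ_abelian : forall i, is_abelian (quotient_set (H i) (J i)))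
  (log_index :
    (ln (subgroup_index (H i) (J i))%:R
       / (subgroup_index [set: G] (H i))%:R : R) @[i --> \oo] --> +oo)
  (rank_growth :
    (0 < limn_esup (fun i => ((group_rank (quotient_set (J i) (K i)))%:R
                              / (subgroup_index [set: G] (J i))%:R : R)%:E))%E) :
  infinite_set [set i | surjects_onto_nonabelian_free (subgroup_type (K i))].
Proof.
have [p freq] := frequently_bounded_below rank_growth.
have [M M_gt0 stage] := surjects_at_finite_stage p.+1 G_fp.
have [N _ big] := (cvgryPge _).1 log_index (ln M%:R + 1).
apply: infinite_of_frequent => N'; have [i] := freq (maxn N N').
rewrite geq_max => /andP[Ni N'i] lt_rank; exists i => //.
apply: stage (H_fin i) (J_fin i) (K_fin i) (JH i) (KJ i) (HJ_abelian i) _ _.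
  exact: index_growth M_gt0 (big i Ni).
(* For the value 0 the inequality is trivial; otherwise the denominator can be cleared. *)
have [->//|idx_gt0] := posnP (subgroup_index [set: G] (J i)).
have {}idx_gt0 : 0 < (subgroup_index [set: G] (J i))%:R :> R by rewrite ltr0n.
move: lt_rank; rewrite ltr_pdivlMr // ltr_pdivrMl // -natrM ltr_nat.
exact: ltnW.
Qed.
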